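(* There is an absolute constant $C$ such that every string graph with $n\ge 4$ vertices admits a $7$-hop spanner with at most $C\, n\log\log n$ edges.
   Context: A string graph is the intersection graph of a finite collection of curves in the plane: the vertices are the curves, and two vertices are adjacent iff the curves intersect. For a graph $G$ and integer $t\ge1$, a $t$-hop spanner is a subgraph $\widehat{G}$ of $G$ on the same vertex set such that for every edge $uv\in E(G)$ there is a $u$–$v$ path in $\widehat{G}$ with at most $t$ edges; its size is its number of edges. *)

(* Defs.v *)
From Stdlib Require Import Reals.
From mathcomp Require Import all_boot.
Set Implicit Arguments. Unset Strict Implicit. Unset Printing Implicit Defensive.

(* A curve in the plane is the image of [0,1] under a continuous map
   t |-> (x t, y t).  (Every continuous map on [0,1] extends continuously
   to R, so requiring continuity on all of R loses nothing.) *)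
Definition is_curve (x y : R -> R) : Prop := continuity x /\ continuity y.

Definition curves_meet (x1 y1 x2 y2 : R -> R) : Prop :=
  exists s t : R, Rle 0 s /\ Rle s 1 /\ Rle 0 t /\ Rle t 1 /\
                  x1 s = x2 t /\ y1 s = y2 t.

Definition string_graph (T : finType) (e : rel T) : Prop :=
  exists cx cy : T -> R -> R,
    (forall u, is_curve (cx u) (cy u)) /\
    (forall u v, e u v <-> (u <> v /\ curves_meet (cx u) (cy u) (cx v) (cy v))).

Definition num_edges (T : finType) (h : rel T) : nat :=
  (#|[set p : T * T | h p.1 p.2]| %/ 2)%N.

Definition hop_spanner (T : finType) (e h : rel T) (t : nat) : Prop :=
  (forall u v, h u v -> e u v) /\
  (forall u v, h u v -> h v u) /\
  (forall u v, e u v ->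
     exists s : seq T, path h u s /\ last u s = v /\ (size s <= t)%N).

(* Main.v *)
(** Replacing each curve by the cells of a fine grid that it visits turns a string graph into the
intersection graph of connected sets of points of Z^2.

_Stars._ Greedily taking disjoint stars with d leaves leaves a set U where every vertex has fewer
than d neighbours.  With d at least the square root of n, one may store a short walk for every
pair of star centers, and then all edges meeting a star are spanned with 7 hops by O(n) edges.

_Separators._ The remaining graph on U has small degree, hence a sublinear balanced separator, as
in the Lipton-Tarjan theorem: every h-th breadth-first level, together with the neighbourhoods of
four root paths starting at the corners of one unit square of the grid.  To find the square, assume
that it does not exist.  Then for each grid edge pq there is a big connected piece avoiding the root
paths of p and q; let side(pq) be the mod 2 winding number around this piece of the closed walk
formed by pq and the two root paths.  These bits sum to 0 around every unit square, because one big
piece avoids all four root paths of its corners, but to 1 around the frame of the grid.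

_Recursion._ Separators split U into overlapping pieces of size at most n^(4/5), of total size
n(1 + o(1)), such that every edge lies in a piece.  Recursing on the pieces has depth
O(log log n), and each level costs O(n) edges. *)

Require Import Defs.
From Stdlib Require Import Reals ZArith Lra Lia ClassicalEpsilon.
From mathcomp Require Import all_boot zify.
From Coquelicot Require Compactness.
Set Implicit Arguments. Unset Strict Implicit. Unset Printing Implicit Defensive.

(** * Crossing parity of grid walks *)

Definition point := (nat * nat)%type.

Definition gadj : rel point := fun p q =>
  ((p.1 == q.1) && ((p.2.+1 == q.2) || (q.2.+1 == p.2))) ||
  ((p.2 == q.2) && ((p.1.+1 == q.1) || (q.1.+1 == p.1))).

(* The step from [p] to [q] crosses the ray going down from [z + (1/2, 1/2)]; this ray meets
   no grid point. *)
Definition crosses_below (z p q : point) : bool :=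
  [&& p.2 == q.2, p.2 <= z.2 &
     ((p.1 == z.1) && (q.1 == z.1.+1)) || ((q.1 == z.1) && (p.1 == z.1.+1))].

(** For a closed walk this is its mod 2 winding number around z + (1/2, 1/2). *)
Fixpoint below_parity (z p : point) (s : seq point) : bool :=
  if s is q :: s' then crosses_below z p q (+) below_parity z q s' else false.

(** The grid points lying between the downward rays of (z.1 - 1, z.2) and of z; this is the
    correction term when the ray moves one column to the right. *)
Definition below_col (z p : point) : bool := (p.1 == z.1) && (p.2 <= z.2).

Lemma below_parity_cat z p s t :
  below_parity z p (s ++ t) = below_parity z p s (+) below_parity z (last p s) t.
Proof. by elim: s p => //= q s IHs p; rewrite IHs addbA. Qed.

(** Raising the ray by one unit adds a single grid edge to those it crosses, and (x, y+1) is an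
    endpoint of that edge. *)
Lemma below_parity_up x y p s :
  (x, y.+1) \notin p :: s ->
  below_parity (x, y.+1) p s = below_parity (x, y) p s.
Proof.
elim: s p => //= q s IHs p; rewrite inE negb_or => /andP[pP qsP].
rewrite IHs //; congr (_ (+) _).
move: qsP; rewrite inE negb_or => /andP[qP _].
case: p q pP qP => [a b] [c d]; rewrite /crosses_below /= !xpair_eqE.
move=> pP qP; case: (b =P d) => //= E; subst d.
have -> : (b <= y.+1) = (b <= y) || (b == y.+1) by rewrite leq_eqVlt orbC.
case: (b =P y.+1) => [E|]; rewrite ?orbF // orbT.
move: pP qP; rewrite E eqxx !andbT ltnn /=.
by rewrite ![x == _]eq_sym => /negbTE-> /negbTE->.
Qed.

Lemma crosses_below_sym z p q : crosses_below z p q = crosses_below z q p.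
Proof.
rewrite /crosses_below eq_sym orbC.
by case: eqP => //= ->.
Qed.

(** The two rays bound a strip holding the points of column x+1 up to height y. A step enters or
    leaves the strip through a ray, or through its top via (x+1, y), which is excluded. *)
Lemma crosses_below_right x y p q :
  gadj p q -> (x.+1, y) != p -> (x.+1, y) != q ->
  crosses_below (x.+1, y) p q =
  crosses_below (x, y) p q (+) below_col (x.+1, y) p (+) below_col (x.+1, y) q.
Proof.
have vert a b : (x.+1, y) != (a, b) -> (x.+1, y) != (a, b.+1) ->
    crosses_below (x.+1, y) (a, b) (a, b.+1) =
    crosses_below (x, y) (a, b) (a, b.+1) (+) below_col (x.+1, y) (a, b)
      (+) below_col (x.+1, y) (a, b.+1).
  rewrite /crosses_below /below_col /= !xpair_eqE => h1 _.
  rewrite (_ : (b == b.+1) = false) /=; last by apply/negbTE; lia.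
  case: (a =P x.+1) h1 => //= ->; rewrite eqxx /= => /eqP h1.
  by case: (ltngtP b y) h1 => // -> [].
have hor a b : (x.+1, y) != (a, b) -> (x.+1, y) != (a.+1, b) ->
    crosses_below (x.+1, y) (a, b) (a.+1, b) =
    crosses_below (x, y) (a, b) (a.+1, b) (+) below_col (x.+1, y) (a, b)
      (+) below_col (x.+1, y) (a.+1, b).
  rewrite /crosses_below /below_col /= !xpair_eqE eqxx /= !eqSS => h1 h2.
  case: (b <= y); rewrite /= ?andbF //.
  by do !case: eqP => ? //=; lia.
case: p q => [a b] [c d]; rewrite /gadj /=.
case/orP=> /andP[/eqP <-] /orP[] /eqP <- pP qP.
- exact: vert.
- by rewrite crosses_below_sym vert // crosses_below_sym -!addbA [X in _ (+) X]addbC.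
- exact: hor.
- by rewrite crosses_below_sym hor // crosses_below_sym -!addbA [X in _ (+) X]addbC.
Qed.

Lemma below_parity_right x y p s :
  path gadj p s -> (x.+1, y) \notin p :: s ->
  below_parity (x.+1, y) p s =
  below_parity (x, y) p s (+) below_col (x.+1, y) p (+) below_col (x.+1, y) (last p s).
Proof.
elim: s p => [|q s IHs] p /=; first by rewrite addbb.
case/andP=> pq qs; rewrite inE negb_or => /andP[pP qsP].
rewrite (IHs _ qs) // crosses_below_right //; last first.
  by move: qsP; rewrite inE negb_or => /andP[].
rewrite -!addbA; congr (_ (+) _).
by rewrite [RHS]addbCA [in LHS](addbCA (below_col _ q)) addKb.
Qed.

(** A discrete Green formula mod 2: when the unit squares are added up, every inner edge cancels and
    the frame remains. *)
Lemma square_parity_sum (H V : nat -> nat -> bool) (N : nat) :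
  (forall x y, x < N -> y < N ->
     H x y (+) H x y.+1 = V x y (+) V x.+1 y) ->
  \big[addb/false]_(x < N) H x 0 (+) \big[addb/false]_(x < N) H x N =
  \big[addb/false]_(y < N) V 0 y (+) \big[addb/false]_(y < N) V N y.
Proof.
move=> sq.
have telescope (f : nat -> bool) n : f 0 (+) f n = \big[addb/false]_(i < n) (f i (+) f i.+1).
  elim: n => [|n IHn]; first by rewrite big_ord0 addbb.
  by rewrite big_ord_recr /= -IHn addbA addbK.
rewrite (telescope (fun y => \big[addb/false]_(x < N) H x y)) -big_split /=.
apply: eq_bigr => y _; rewrite -big_split /= (telescope (V^~ y)).
by apply: eq_bigr => x _; apply: sq.
Qed.

Fixpoint left_walk (x y : nat) : seq point :=
  if x is x'.+1 then (x', y) :: left_walk x' y else [::].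

Fixpoint down_walk (x y : nat) : seq point :=
  if y is y'.+1 then (x, y') :: down_walk x y' else [::].

Lemma path_left_walk x y : path gadj (x, y) (left_walk x y).
Proof. by elim: x => //= x ->; rewrite /gadj /= !eqxx !orbT. Qed.

Lemma path_down_walk x y : path gadj (x, y) (down_walk x y).
Proof. by elim: y => //= y ->; rewrite /gadj /= !eqxx !orbT. Qed.

Lemma last_left_walk x y : last (x, y) (left_walk x y) = (0, y).
Proof. by elim: x. Qed.

Lemma last_down_walk x y : last (x, y) (down_walk x y) = (x, 0).
Proof. by elim: y. Qed.

Lemma mem_left_walk x y z : z \in left_walk x y -> z.2 = y.
Proof. by elim: x => //= x IHx; rewrite inE => /orP[/eqP->|/IHx]. Qed.

Lemma mem_down_walk x y z : z \in down_walk x y -> z.1 = x.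
Proof. by elim: y => //= y IHy; rewrite inE => /orP[/eqP->|/IHy]. Qed.

Lemma below_parity_left_walk z x y :
  below_parity z (x, y) (left_walk x y) = (z.1 < x) && (y <= z.2).
Proof.
elim: x => //= x ->; rewrite /crosses_below /= eqxx /= ltnS.
rewrite eqSS (ltn_neqAle z.1 x) (_ : (x.+1 == z.1) && (x == z.1.+1) = false).
  by rewrite andbb eq_sym; case: eqP => [->|]; case: (y <= z.2); rewrite ?leqnn ?andbF ?andbT.
by apply/negbTE; lia.
Qed.

Lemma below_parity_down_walk z x y :
  below_parity z (x, y) (down_walk x y) = false.
Proof.
elim: y => //= y ->; rewrite /crosses_below /= (_ : (y.+1 == y) = false) //.
by apply/negbTE; lia.
Qed.

Definition inside_box (N : nat) (p : point) : bool :=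
  [&& 0 < p.1, p.1 < N, 0 < p.2 & p.2 < N].

(** * Balancing along four walks *)

Definition linked (T : finType) (S : T -> seq point) (Q : {set T}) : Prop :=
  forall u v p q, u \in Q -> v \in Q -> p \in S u -> q \in S v ->
    exists s, [/\ path gadj p s, last p s = q &
                  forall z, z \in s -> exists2 w, w \in Q & z \in S w].

Definition touched (T : finType) (S : T -> seq point) (K : {set T})
    (s : seq point) : {set T} := [set u in K | has (mem (S u)) s].

Section FourWalks.

Variables (T : finType) (S : T -> seq point) (N c : nat) (K : {set T}).
Variable conn : pred {set T}.
Hypothesis conn_linked : forall Q, conn Q -> linked S Q.
Hypothesis S_neq0 : forall u, u \in K -> S u != [::].
Hypothesis S_inside : forall u p, u \in K -> p \in S u -> inside_box N p.

Variable pi : point -> seq point.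
Hypothesis path_pi : forall p, path gadj p (pi p).
Hypothesis last_pi : forall p, last p (pi p) = (0, 0).
Local Notation N_ p := (touched S K (p :: pi p)).

(** The mod 2 winding number around z + (1/2, 1/2) of the closed walk formed by the edge pq and the
    two root walks. *)
Definition edge_parity (p q z : point) : bool :=
  below_parity z p (pi p) (+) below_parity z q (pi q) (+) crosses_below z p q.

Lemma avoid_touched (Q : {set T}) p w z :
  Q \subset K :\: N_ p -> w \in Q -> z \in S w -> z \notin p :: pi p.
Proof.
move=> QK wQ zw; apply/negP=> zp.
move/subsetP/(_ w wQ): QK; rewrite in_setD inE => /andP[/negP nw wK].
by apply: nw; rewrite wK; apply/hasP; exists z.
Qed.

(** The winding number does not change while z moves off the closed walk. In a move to the right,
    the corrections at p, at q and at the common end (0, 0) each occur twice and cancel. *)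
Lemma edge_parity_step p q z z' : gadj p q -> gadj z z' ->
  z \notin p :: pi p -> z \notin q :: pi q ->
  z' \notin p :: pi p -> z' \notin q :: pi q ->
  edge_parity p q z = edge_parity p q z'.
Proof.
have up x y : (x, y.+1) \notin p :: pi p -> (x, y.+1) \notin q :: pi q ->
    edge_parity p q (x, y.+1) = edge_parity p q (x, y).
  move=> yp yq; rewrite /edge_parity !below_parity_up //.
  congr (_ (+) _); have := @below_parity_up x y p [:: q].
  rewrite /= !addbF; apply; move: yp yq; rewrite !inE !negb_or.
  by move=> /andP[-> _] /andP[-> _].
have right x y : gadj p q ->
    (x.+1, y) \notin p :: pi p -> (x.+1, y) \notin q :: pi q ->
    edge_parity p q (x.+1, y) = edge_parity p q (x, y).
  move=> pq yp yq; rewrite /edge_parity !below_parity_right ?path_pi //.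
  rewrite !last_pi crosses_below_right //; first last.
  - by move: yq; rewrite inE negb_or => /andP[].
  - by move: yp; rewrite inE negb_or => /andP[].
  move: (below_parity _ p _) (below_parity _ q _) (crosses_below _ _ _).
  move: (below_col _ _) (below_col _ p) (below_col _ q).
  by do 6!case.
move=> pq; case: z z' => [a b] [a' b']; rewrite /gadj /=.
by case/orP=> /andP[/eqP <-] /orP[] /eqP <- ? ? ? ?;
  rewrite ?up ?right // -?up -?right.
Qed.

Lemma edge_parity_const (Q : {set T}) p q u v z z' : gadj p q -> conn Q ->
  Q \subset K :\: N_ p -> Q \subset K :\: N_ q ->
  u \in Q -> v \in Q -> z \in S u -> z' \in S v ->
  edge_parity p q z = edge_parity p q z'.
Proof.
move=> pq /conn_linked lQ Qp Qq uQ vQ zu z'v.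
have [s [zs sz' sQ]] := lQ _ _ _ _ uQ vQ zu z'v.
move: z'v; rewrite -{}sz' => _; elim: s z u uQ zu zs sQ => //= y s IHs z u uQ zu /andP[zy ys] sQ.
have [w wQ yw] : exists2 w, w \in Q & y \in S w by apply: sQ; rewrite inE eqxx.
rewrite (@edge_parity_step p q z y) //; last first.
- exact: (avoid_touched Qq wQ).
- exact: (avoid_touched Qp wQ).
- exact: (avoid_touched Qq uQ).
- exact: (avoid_touched Qp uQ).
by apply: IHs wQ yw ys _ => t ts; apply: sQ; rewrite inE ts orbT.
Qed.

(* Only the ray issued from the centre of a unit square crosses its boundary an odd number of
   times. *)
Lemma edge_parity_square x y z : z != (x, y) ->
  edge_parity (x, y) (x.+1, y) z (+) edge_parity (x, y.+1) (x.+1, y.+1) z =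
  edge_parity (x, y) (x, y.+1) z (+) edge_parity (x.+1, y) (x.+1, y.+1) z.
Proof.
move=> zxy; rewrite /edge_parity.
have vert a : crosses_below z (a, y) (a, y.+1) = false.
  by rewrite /crosses_below /= (_ : (y == y.+1) = false) //; apply/negbTE; lia.
have -> : crosses_below z (x, y.+1) (x.+1, y.+1) = crosses_below z (x, y) (x.+1, y).
  case: z zxy {vert} => a b; rewrite xpair_eqE /crosses_below /= !eqxx /= !eqSS.
  rewrite ltn_neqAle ![_ == a]eq_sym.
  case: (a =P x) => [->|] /=; last by rewrite (_ : (a == x.+1) && (x == a.+1) = false) ?andbF //; apply/negbTE; lia.
  by rewrite eq_sym => ->.
rewrite !vert.
move: (crosses_below _ _ _) (below_parity _ (x, y) _) (below_parity _ (x.+1, y) _).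
move: (below_parity _ (x, y.+1) _) (below_parity _ (x.+1, y.+1) _).
by do 5!case.
Qed.

Hypothesis pi_bottom : forall x, pi (x, 0) = left_walk x 0.
Hypothesis pi_left : forall y, pi (0, y) = down_walk 0 y.
Hypothesis pi_right : forall y, pi (N, y) = down_walk N y ++ left_walk N 0.
Hypothesis pi_top : forall x, x < N -> pi (x, N) = left_walk x N ++ down_walk 0 N.
Hypothesis card_touched : forall p, p.1 <= N -> p.2 <= N -> #|N_ p| <= c.

(** By contradiction: suppose every set of at most 4c members leaves a connected piece with more
    than half of K. Two majority pieces always share a member, so the parity of an edge can be read
    off any majority piece that avoids its two root walks. The factor 4 lets one piece avoid the
    walks of all four corners of a square. *)
Lemma four_walks_separate :
  exists2 X : {set T}, (X \subset K) && (#|X| <= 4 * c) &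
    forall Q : {set T}, Q \subset K :\: X -> conn Q -> 2 * #|Q| <= #|K|.
Proof.
set good := fun X Q : {set T} => [&& Q \subset K :\: X, conn Q & #|K| < 2 * #|Q|].
have [/existsP[X /andP[XK /forallP nQ]]|nX] := boolP [exists X : {set T},
    (X \subset K) && (#|X| <= 4 * c) && [forall Q, ~~ good X Q]].
  exists X => // Q QX cQ; have := nQ Q; rewrite /good QX cQ /=; lia.
(* The default is never taken for a subset of K with at most 4c members, by [nX]. *)
pose big X := odflt set0 [pick Q | good X Q].
have bigP (X : {set T}) : X \subset K -> #|X| <= 4 * c -> good X (big X).
  move=> XK Xc; rewrite /big; case: pickP => //= nQ.
  case/negP: nX; apply/existsP; exists X; rewrite XK Xc /=.
  by apply/forallP=> Q; rewrite nQ.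
have NK p : N_ p \subset K by apply/subsetP=> u; rewrite inE => /andP[].
pose pt w := head (0, 0) (S w).
have pt_in w : w \in K -> pt w \in S w.
  by move/S_neq0; rewrite /pt; case: (S w) => //= a s _; rewrite inE eqxx.
(* The parity is constant on the piece, so asking for some w amounts to asking for any w. *)
pose side p q := [exists w in big (N_ p :|: N_ q), edge_parity p q (pt w)].
have box p q : p.1 <= N -> p.2 <= N -> q.1 <= N -> q.2 <= N ->
    good (N_ p :|: N_ q) (big (N_ p :|: N_ q)).
  move=> p1 p2 q1 q2; apply: bigP; first by rewrite subUset !NK.
  apply: leq_trans (leq_card_setU _ _) _.
  have := card_touched p1 p2; have := card_touched q1 q2; lia.
have sideE p q Q w : p.1 <= N -> p.2 <= N -> q.1 <= N -> q.2 <= N ->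
    gadj p q -> conn Q -> #|K| < 2 * #|Q| ->
    Q \subset K :\: N_ p -> Q \subset K :\: N_ q -> w \in Q ->
    side p q = edge_parity p q (pt w).
  move=> p1 p2 q1 q2 pq cQ Qbig Qp Qq wQ.
  have QK : Q \subset K by apply: subset_trans Qp (subsetDl _ _).
  have /and3P[] := box _ _ p1 p2 q1 q2.
  rewrite setDUr subsetI => /andP[Bp Bq] cB Bbig.
  have BK : big (N_ p :|: N_ q) \subset K by apply: subset_trans Bp (subsetDl _ _).
  (* Both sets have more than half of K, hence a common member v. The parity is then carried from w
     to v inside Q and from v onwards inside the chosen piece. *)
  have [v vQ vB] : exists2 v, v \in Q & v \in big (N_ p :|: N_ q).
    apply/exists_inP; rewrite -[X in is_true X]negbK; apply/negP=> /exists_inPn dis.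
    have : #|Q :|: big (N_ p :|: N_ q)| <= #|K|.
      by apply: subset_leq_card; rewrite subUset QK.
    rewrite cardsU (_ : Q :&: _ = set0) ?cards0 => [UK|].
      by move: UK Qbig Bbig; clear; lia.
    by apply/setP=> u; rewrite !inE; apply/negbTE/negP=> /andP[/dis/negP].
  have vK : v \in K by exact: (subsetP QK).
  have wK : w \in K by exact: (subsetP QK).
  rewrite -(edge_parity_const pq cQ Qp Qq vQ wQ (pt_in _ vK) (pt_in _ wK)).
  apply/exists_inP/idP => [[u uB]|]; last by exists v.
  have uK : u \in K by exact: (subsetP BK).
  by rewrite (edge_parity_const pq cB Bp Bq uB vB (pt_in _ uK) (pt_in _ vK)).
have sub_touched p (X Q : {set T}) : N_ p \subset X -> Q \subset K :\: X ->
    Q \subset K :\: N_ p.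
  by move=> pX /subset_trans; apply; apply: setDS.
have big_inside p q : p.1 <= N -> p.2 <= N -> q.1 <= N -> q.2 <= N -> gadj p q ->
    exists2 z, inside_box N z & side p q = edge_parity p q z.
  move=> p1 p2 q1 q2 pq; have /and3P[Bp cB Bbig] := box _ _ p1 p2 q1 q2.
  have [w wB] : exists w, w \in big (N_ p :|: N_ q).
    by apply/set0Pn; apply: contraTneq Bbig => ->; rewrite cards0.
  have wK : w \in K by move/subsetP/(_ w wB): Bp; rewrite inE => /andP[].
  exists (pt w); first exact: S_inside (pt_in _ wK).
  apply: (sideE p q _ w _ _ _ _ _ cB) => //.
    by apply: sub_touched Bp; apply: subsetUl.
  by apply: sub_touched Bp; apply: subsetUr.
have hor x y : gadj (x, y) (x.+1, y) by rewrite /gadj /= !eqxx orbT.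
have ver x y : gadj (x, y) (x, y.+1) by rewrite /gadj /= !eqxx.
have square x y : x < N -> y < N ->
    side (x, y) (x.+1, y) (+) side (x, y.+1) (x.+1, y.+1) =
    side (x, y) (x, y.+1) (+) side (x.+1, y) (x.+1, y.+1).
  move=> xN yN; have xN' := ltnW xN; have yN' := ltnW yN.
  pose X := N_ (x, y) :|: N_ (x.+1, y) :|: N_ (x, y.+1) :|: N_ (x.+1, y.+1).
  have XK : X \subset K by rewrite !subUset !NK.
  have Xc : #|X| <= 4 * c.
    apply: (@leq_trans (c + c + c + c)); last by rewrite !mulSn mul0n addn0 !addnA.
    have cardU (A B : {set T}) a b : #|A| <= a -> #|B| <= b -> #|A :|: B| <= a + b.
      by move=> Aa Bb; apply: leq_trans (leq_card_setU A B) _; apply: leq_add.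
    by rewrite /X !cardU // card_touched.
  have /and3P[] := bigP _ XK Xc; set Q := big X => QX cQ Qbig.
  have [w wQ] : exists w, w \in Q.
    by apply/set0Pn; apply: contraTneq Qbig => ->; rewrite cards0.
  have wK : w \in K by move/subsetP/(_ w wQ): QX; rewrite inE => /andP[].
  have Qa : Q \subset K :\: N_ (x, y).
    by apply: sub_touched QX; rewrite /X -!setUA subsetUl.
  have Qb : Q \subset K :\: N_ (x.+1, y).
    by apply: sub_touched QX; rewrite /X -!setUA setUCA subsetUl.
  have Qc : Q \subset K :\: N_ (x, y.+1).
    by apply: sub_touched QX; rewrite /X setUAC subsetUr.
  have Qd : Q \subset K :\: N_ (x.+1, y.+1).
    by apply: sub_touched QX; rewrite /X subsetUr.
  (* All four parities are read at the same point of w. It differs from (x, y), which lies on a root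
     walk that Q avoids. *)
  rewrite !(sideE _ _ Q w) //; apply: edge_parity_square.
  have := avoid_touched Qa wQ (pt_in _ wK).
  by rewrite inE negb_or => /andP[].
(* N is positive: the piece left by the empty set is nonempty, and its strings lie strictly inside
   the box. *)
have N1 : N.-1 < N.
  have /and3P[B0 _ Bbig] := bigP set0 (sub0set K) (leq_trans (eq_leq (cards0 T)) (leq0n _)).
  have [w wB] : exists w, w \in big set0.
    by apply/set0Pn; apply: contraTneq Bbig => ->; rewrite cards0.
  have wK : w \in K by move/subsetP/(_ w wB): B0; rewrite inE => /andP[].
  have /and4P[_ zN _ _] := S_inside wK (pt_in _ wK).
  by rewrite prednK // (leq_trans _ zN).
have D_bottom z x : below_parity z (x, 0) (pi (x, 0)) = (z.1 < x).
  by rewrite pi_bottom below_parity_left_walk andbT.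
have D_left z y : below_parity z (0, y) (pi (0, y)) = false.
  by rewrite pi_left below_parity_down_walk.
have D_right z y : below_parity z (N, y) (pi (N, y)) = (z.1 < N).
  rewrite pi_right below_parity_cat below_parity_down_walk last_down_walk.
  by rewrite below_parity_left_walk andbT.
have D_top z x : inside_box N z -> x < N -> below_parity z (x, N) (pi (x, N)) = false.
  move=> /and4P[_ _ _ zN] xN; rewrite pi_top // below_parity_cat below_parity_left_walk.
  by rewrite last_left_walk below_parity_down_walk (leqNgt N) zN andbF.
have side_bottom x : x < N -> side (x, 0) (x.+1, 0) = false.
  move=> xN; have [|||||z zin ->] := big_inside (x, 0) (x.+1, 0) => //; first exact: ltnW.
  rewrite /edge_parity !D_bottom /crosses_below /= [_ < x.+1]leq_eqVlt eqSS ltnS.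
  rewrite (_ : (x.+1 == z.1) && (x == z.1.+1) = false); last by apply/negbTE; lia.
  rewrite orbF.
  rewrite ?eqSS ?andbb.
  by case: (ltngtP z.1 x).
have side_left y : y < N -> side (0, y) (0, y.+1) = false.
  move=> yN; have [|||||z zin ->] := big_inside (0, y) (0, y.+1) => //; first exact: ltnW.
  rewrite /edge_parity !D_left /crosses_below /= (_ : (y == y.+1) = false) //.
  by apply/negbTE; lia.
have side_right y : y < N -> side (N, y) (N, y.+1) = false.
  move=> yN; have [|||||z zin ->] := big_inside (N, y) (N, y.+1) => //; first exact: ltnW.
  rewrite /edge_parity !D_right addbb /crosses_below /= (_ : (y == y.+1) = false) //.
  by apply/negbTE; lia.
(* The root walk of (N-1, N) follows the top and left sides, that of (N, N) the right and bottom
   sides. Only this edge closes up to a walk around the whole frame. *)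
have side_top x : x < N -> side (x, N) (x.+1, N) = (x == N.-1).
  move=> xN; have [|||||z zin ->] := big_inside (x, N) (x.+1, N) => //; first exact: ltnW.
  have /and4P[_ z1N _ z2N] := zin.
  rewrite /edge_parity D_top // /crosses_below /= [N <= _]leqNgt z2N /= andbF addbF.
  case: (x =P N.-1) => [->|nx].
    by rewrite prednK ?D_right // (leq_trans _ N1).
  by rewrite D_top //; lia.
have zero (f : nat -> bool) : (forall x, x < N -> f x = false) ->
    \big[addb/false]_(x < N) f x = false by move=> f0; rewrite big1 // => x _; apply: f0.
have := square_parity_sum square.
rewrite (zero _ side_left) (zero _ side_right) (zero _ side_bottom).
rewrite (bigD1 (Ordinal N1)) //= side_top // eqxx big1 // => x.
by rewrite side_top // -val_eqE /= => /negbTE.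
Qed.

End FourWalks.

(** * Separators *)

Definition connected (T : finType) (e : rel T) : pred {set T} := fun Q =>
  [forall u in Q, forall v in Q,
     connect [rel x y | [&& x \in Q, y \in Q & e x y]] u v].

Lemma connectedP (T : finType) (e : rel T) (Q : {set T}) u v :
  connected e Q -> u \in Q -> v \in Q ->
  exists s, [/\ path e u s, last u s = v & {subset s <= Q}].
Proof.
move=> /forall_inP cQ uQ vQ.
have /forall_inP/(_ v vQ)/connectP[s ps ->] := cQ u uQ.
exists s; elim: s u uQ ps => [|w s IHs] u uQ /=; first by [].
case/andP=> /and3P[_ wQ uw] /(IHs _ wQ)[-> _ sQ]; split; rewrite ?uw // => z.
by rewrite inE => /orP[/eqP->|/sQ].
Qed.

Lemma connected_levels (T : finType) (e : rel T) (W : {set T}) (r : T) :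
  connected e W -> r \in W ->
  exists lev : T -> nat,
    [/\ forall v, v \in W -> lev v = 0 -> v = r,
        forall v k, v \in W -> lev v = k.+1 -> exists u, [/\ u \in W, e u v & lev u = k]
      & forall u v, u \in W -> v \in W -> e u v -> lev v <= (lev u).+1].
Proof.
move=> cW rW.
pose ball k := iter k (fun B : {set T} => B :|: [set v in W | [exists u in B, e u v]]) [set r].
have ballS k v : (v \in ball k.+1) = (v \in ball k) || ((v \in W) && [exists u in ball k, e u v]).
  by rewrite /ball iterS -/(ball k) !inE.
have ex v : exists k, (v \in W) ==> (v \in ball k).
  case: (boolP (v \in W)) => [vW|_]; last by exists 0.
  have [s [rs <- sW]] := connectedP cW rW vW.
  suff gen k u : u \in ball k -> path e u s -> exists k', last u s \in ball k'.
    by apply: (gen 0 r) => //; rewrite inE.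
  elim: s {rs vW} sW k u => [|w s IHs] sW k u uB /=; first by exists k.
  case/andP=> uw ws; apply: (IHs _ k.+1 w) => //.
    by move=> z zs; apply: sW; rewrite inE zs orbT.
  rewrite ballS sW ?inE ?eqxx //=; apply/orP; right.
  by apply/exists_inP; exists u.
have [lev levP] : exists lev : T -> nat, forall v, v \in W ->
    v \in ball (lev v) /\ forall k, v \in ball k -> lev v <= k.
  exists (fun v => ex_minn (ex v)) => v vW; case: ex_minnP => m.
  by rewrite vW => vB min; split=> // k kB; apply: min; rewrite vW.
exists lev; split=> [v vW v0|v k vW vk|u v uW vW uv].
- by have [] := levP v vW; rewrite v0 inE => /eqP.
- have [] := levP v vW; rewrite vk ballS => /orP[vB /(_ _ vB)|]; first by rewrite ltnn.
  rewrite vW /= => /exists_inP[u uB uv] min; exists u.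
  have uW : u \in W.
    elim: k uB {min vk} => [|k IHk]; first by rewrite inE => /eqP->.
    by rewrite ballS => /orP[//|/andP[]].
  have [uB' uk] := levP u uW.
  split=> //.
  apply/eqP; rewrite eqn_leq uk //= -ltnS; apply: min.
  rewrite ballS vW; apply/orP; right.
  by apply/exists_inP; exists u.
- have [uB _] := levP u uW; have [_] := levP v vW; apply.
  rewrite ballS vW; apply/orP; right.
  by apply/exists_inP; exists u.
Qed.

(** Bounds the number of levels on which a root path can come next to a slab of levels; the indices
    counted lie between a - 1 and b. *)
Lemma count_interval (a b n : nat) :
  count (fun j => (a <= j.+1) && (j <= b)) (iota 0 n) <= b.+2 - a.
Proof.
suff : count (fun j => (a <= j.+1) && (j <= b)) (iota 0 n) <= (minn n b.+1).+1 - a by lia.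
elim: n => [|n IHn] //; rewrite -addn1 iotaD count_cat /= add0n addn0.
case: andP => [[an nb]|nn]; first by rewrite /=; lia.
by rewrite /= addn0; apply: leq_trans IHn _; lia.
Qed.

(** The combinatorial substitute for curves: distinct vertices are adjacent exactly when their point
    sets share a point. The strings stay off the frame of the box, so walks along the frame meet
    none of them. *)
Record grid_strings (T : finType) (e : rel T) (S : T -> seq point) (N : nat) : Prop :=
  GridStrings {
    strings_neq0 : forall u, S u != [::];
    strings_inside : forall u p, p \in S u -> inside_box N p;
    strings_connected : forall u p q, p \in S u -> q \in S u ->
      exists s, [/\ path gadj p s, last p s = q & {subset s <= S u}];
    strings_adjacent : forall u v, e u v -> has (mem (S u)) (S v);
    strings_meet : forall u v p, u != v -> p \in S u -> p \in S v -> e u v }.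

Section Separator.

Variables (T : finType) (e : rel T) (S : T -> seq point) (N : nat).
Hypothesis eS : grid_strings e S N.

Lemma linked_connected Q : connected e Q -> linked S Q.
Proof.
move=> cQ u v p q uQ vQ pu qv.
have [t [ut tv tQ]] := connectedP cQ uQ vQ.
elim: t u uQ p pu ut tv tQ => [|w t IHt] u uQ p pu /=.
  move=> _ uv _; rewrite -{}uv in qv.
  have [s [ps sq sS]] := strings_connected eS pu qv.
  by exists s; split=> // z /sS zu; exists u.
case/andP=> uw wt tv tQ; have wQ : w \in Q by apply: tQ; rewrite inE eqxx.
have /hasP[z zw zu] := strings_adjacent eS uw.
have [s [ps sz sS]] := strings_connected eS pu zu.
have [|s' [ps' s'q s'S]] := IHt w wQ z zw wt tv.
  by move=> y yt; apply: tQ; rewrite inE yt orbT.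
exists (s ++ s'); rewrite cat_path last_cat ps sz; split=> // y.
by rewrite mem_cat => /orP[/sS yu|/s'S//]; exists u.
Qed.

Variables (W K : {set T}) (d lo h : nat) (r : T) (lev : T -> nat).
Hypothesis KW : K \subset W.
Hypothesis degW : forall v, v \in W -> #|[set w in W | e v w]| <= d.
Hypothesis rW : r \in W.
Hypothesis lev0 : forall v, v \in W -> lev v = 0 -> v = r.
Hypothesis levS : forall v k, v \in W -> lev v = k.+1 ->
  exists u, [/\ u \in W, e u v & lev u = k].
Hypothesis lev_adj : forall u v, u \in W -> v \in W -> e u v -> lev v <= (lev u).+1.
Hypothesis e_sym : symmetric e.
Hypothesis slab : forall v, v \in K -> lo <= lev v < lo + h.

Variable o : point.
Hypothesis o_r : o \in S r.
Hypothesis o_left : forall v p, v \in W -> p \in S v -> o.1 <= p.1.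

Let NK v := [set w in K | (w == v) || e v w].

(** A bound on the members of K met by a root walk from level k: one closed neighbourhood, of size
    at most d+1, for each level within one of the slab. Vertices on other levels have no neighbour
    in K. *)
Let cost k := d.+1 * count (fun j => (lo <= j.+1) && (j <= lo + h)) (iota 0 k.+1).

Let costS k : cost k.+1 = cost k + d.+1 * ((lo <= k.+2) && (k.+1 <= lo + h)).
Proof.
have iotaS : iota 0 k.+2 = iota 0 k.+1 ++ [:: k.+1] by rewrite -[k.+2]addn1 iotaD.
by rewrite /cost iotaS count_cat mulnDr /= addn0.
Qed.

Let card_NK v : v \in W -> #|NK v| <= d.+1 * ((lo <= (lev v).+1) && (lev v <= lo + h)).
Proof.
move=> vW; case: (boolP ((lo <= _) && _)) => [_|nv].
  rewrite muln1; apply: leq_trans (_ : #|v |: [set w in W | e v w]| <= _).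
    apply/subset_leq_card/subsetP=> w; rewrite !inE => /andP[wK].
    by rewrite (subsetP KW).
  by rewrite cardsU1 -[d.+1]add1n; apply: leq_add (leq_b1 _) (degW vW).
rewrite muln0 leqn0 cards_eq0; apply/eqP/setP=> w; rewrite !inE; apply/negbTE.
apply/negP=> /andP[wK vw]; have /andP[lw wh] := slab wK.
have wW := subsetP KW _ wK.
case/negP: nv; case/orP: vw => [/eqP<-|vw]; first by rewrite ltnW //= ltnW.
have := lev_adj vW wW vw; rewrite e_sym in vw; have := lev_adj wW vW vw.
by move: lw wh; clear; lia.
Qed.

Let touched_string v p s : p \in S v -> {subset s <= S v} ->
  touched S K (p :: s) \subset NK v.
Proof.
move=> pv sv; apply/subsetP=> w; rewrite !inE => /andP[-> /hasP[z zps zw]] /=.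
have zv : z \in S v by move: zps; rewrite inE => /orP[/eqP->|/sv].
have [//|nwv] := eqVneq w v.
by apply: (strings_meet eS _ zv zw); rewrite eq_sym.
Qed.

Lemma touched_cat s t : touched S K (s ++ t) = touched S K s :|: touched S K t.
Proof. by apply/setP=> w; rewrite !inE has_cat andb_orr. Qed.

Lemma touched0 s : {in s & W, forall z w, z \notin S w} -> touched S K s = set0.
Proof.
move=> sW; apply/setP=> w; rewrite !inE; apply/negbTE/negP=> /andP[wK /hasP[z zs zw]].
by move/negP: (sW z w zs (subsetP KW _ wK)); apply.
Qed.

(** Follow the string of v to a point shared with its breadth-first parent, and continue from there.
    At the root, go to the leftmost point o, then left to column 0 and down: no string of W lies on
    that tail. *)
Lemma root_walk v p : v \in W -> p \in S v ->
  exists s, [/\ path gadj p s, last p s = (0, 0) & #|touched S K (p :: s)| <= cost (lev v)].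
Proof.
move: {2}(lev v) (erefl (lev v)) => k; elim: k v p => [|k IHk] v p vk vW pv; rewrite vk.
  have vr := lev0 vW vk; rewrite {}vr in vk vW pv.
  have [s [ps so sS]] := strings_connected eS pv o_r.
  exists (s ++ left_walk o.1 o.2 ++ down_walk 0 o.2).
  rewrite !cat_path !last_cat ps so [o in path _ o _]surjective_pairing path_left_walk.
  rewrite [o in last o _]surjective_pairing last_left_walk path_down_walk last_down_walk.
  split=> //; rewrite -cat_cons touched_cat [X in _ :|: X]touched0.
    rewrite setU0; apply: leq_trans (subset_leq_card (touched_string pv sS)) _.
    by apply: leq_trans (card_NK vW) _; rewrite vk /cost /= addn0.
  move=> z w; rewrite mem_cat => /orP[zl|/mem_down_walk z0] wW; apply/negP=> zw.
    have := o_left wW zw; rewrite leqNgt => /negP; apply.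
    by elim: {ps so} (o.1) zl => //= x IHx; rewrite inE => /orP[/eqP->|/IHx/leqW].
  by have := strings_inside eS zw; rewrite /inside_box z0.
have [u [uW uv uk]] := levS vW vk.
have /hasP[z zv zu] := strings_adjacent eS uv.
have [s [ps sz sS]] := strings_connected eS pv zv.
have [s' [zs' s'0 cs']] := IHk u z uk uW zu.
exists (s ++ s'); rewrite cat_path last_cat ps sz; split=> //.
rewrite -cat_cons touched_cat; apply: leq_trans (leq_card_setU _ _) _.
rewrite costS addnC leq_add //.
  apply: leq_trans (subset_leq_card _) _; last by rewrite -uk; exact: cs'.
  by apply/subsetP=> w; rewrite !inE /= => /andP[-> ->]; rewrite orbT.
apply: leq_trans (subset_leq_card (touched_string pv sS)) _.
by rewrite -vk; apply: card_NK.
Qed.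

(** Move left until a string of W is hit or column 0 is reached. These moves touch nothing, and a
    root walk finishes the job; it costs at most h+2 neighbourhoods. *)
Lemma box_walk p :
  exists s, [&& path gadj p s, last p s == (0, 0) &
                #|touched S K (p :: s)| <= d.+1 * h.+2].
Proof.
case: p => x y; elim: x => [|x [s /and3P[ps /eqP s0 cs]]].
  exists (down_walk 0 y); rewrite path_down_walk last_down_walk eqxx.
  rewrite touched0 ?cards0 // => z w zs wW; apply/negP=> /(strings_inside eS).
  by move: zs; rewrite inE /inside_box => /orP[/eqP->|/mem_down_walk->].
have [/exists_inP[v vW pv]|nW] := boolP [exists v in W, (x.+1, y) \in S v].
  have [t [pt t0 ct]] := root_walk vW pv; exists t.
  rewrite pt t0 eqxx !andTb; apply: leq_trans ct _; rewrite leq_mul2l; apply/orP; right.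
  by apply: leq_trans (count_interval _ _ _) _; lia.
exists ((x, y) :: s); rewrite /= ps s0 eqxx !andbT /gadj /= !eqxx !orbT /=.
rewrite -cat1s touched_cat touched0 ?set0U // => z w; rewrite inE => /eqP-> wW.
by move/exists_inPn: nW; apply.
Qed.

Lemma slab_separator :
  exists2 X : {set T}, (X \subset K) && (#|X| <= 4 * (d.+1 * h.+2)) &
    forall Q : {set T}, Q \subset K :\: X -> connected e Q -> 2 * #|Q| <= #|K|.
Proof.
(* Frame points walk along the frame and touch no string. Testing the right side before the top
   sends the corner (N, N) down the right side. *)
pose pi (p : point) :=
  if p.2 == 0 then left_walk p.1 0
  else if p.1 == 0 then down_walk 0 p.2
  else if p.1 == N then down_walk N p.2 ++ left_walk N 0
  else if p.2 == N then left_walk p.1 N ++ down_walk 0 N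
  else xchoose (box_walk p).
have last_d x y : last (x, y) (down_walk x y) = (x, 0) by exact: last_down_walk.
have spec p : [&& path gadj p (pi p), last p (pi p) == (0, 0) &
                #|touched S K (p :: pi p)| <= d.+1 * h.+2].
  have empty s : (forall z, z \in s -> ~~ inside_box N z) -> #|touched S K s| <= d.+1 * h.+2.
    move=> s_out; rewrite touched0 ?cards0 // => z w zs wW; apply/negP=> /(strings_inside eS).
    exact/negP/s_out.
  case: p => x y; rewrite /pi /=.
  case: (y =P 0) => [->|y0].
    rewrite path_left_walk last_left_walk eqxx empty // => z; rewrite inE /inside_box.
    by case/orP=> [/eqP->|/mem_left_walk->]; rewrite /= !andbF.
  case: (x =P 0) => [->|x0].
    rewrite path_down_walk last_down_walk eqxx empty // => z; rewrite inE /inside_box.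
    by case/orP=> [/eqP->|/mem_down_walk->].
  case: (x =P N) => [->|xN].
    rewrite cat_path path_down_walk last_cat last_down_walk path_left_walk last_left_walk.
    rewrite eqxx empty // => z; rewrite inE mem_cat /inside_box.
    by case/or3P=> [/eqP->|/mem_down_walk->|/mem_left_walk->]; rewrite /= ?ltnn !andbF.
  case: (y =P N) => [->|yN]; last exact: (xchooseP (box_walk (x, y))).
  rewrite cat_path path_left_walk last_cat last_left_walk path_down_walk last_down_walk.
  rewrite eqxx empty // => z; rewrite inE mem_cat /inside_box.
  by case/or3P=> [/eqP->|/mem_left_walk->|/mem_down_walk->]; rewrite /= ?ltnn ?andbF.
apply: (@four_walks_separate T S N _ K (connected e) linked_connected _ _ pi).
- by move=> u _; apply: strings_neq0 eS _.
- by move=> u p _; apply: (strings_inside eS).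
- by move=> p; have /and3P[] := spec p.
- by move=> p; have /and3P[_ /eqP] := spec p.
- by [].
- by move=> y; rewrite /pi /=; case: eqP => [->|].
- by move=> y; rewrite /pi /=; case: eqP => [->|_] //; case: eqP => [->|]; rewrite ?eqxx ?cats0.
- move=> x xN; rewrite /pi /= eqxx (ltn_eqF xN) gtn_eqF ?(leq_ltn_trans _ xN) //.
  by case: eqP => [->|].
- by move=> p _ _; have /and3P[] := spec p.
Qed.

End Separator.

(** * Connected components *)

Section Components.

Variables (T : finType) (e : rel T).
Hypothesis e_sym : symmetric e.

Definition component (W : {set T}) (u : T) : {set T} :=
  [set v in W | connect [rel x y | [&& x \in W, y \in W & e x y]] u v].

Lemma component_sub W u : component W u \subset W.
Proof. by apply/subsetP=> v; rewrite inE => /andP[]. Qed.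

Lemma component_refl (W : {set T}) u : u \in W -> u \in component W u.
Proof. by move=> uW; rewrite inE uW connect0. Qed.

Lemma component_closed (W : {set T}) u v w :
  v \in component W u -> w \in W -> e v w -> w \in component W u.
Proof.
rewrite !inE => /andP[vW uv] wW vw; rewrite wW; apply: connect_trans uv (connect1 _).
by rewrite /= vW wW.
Qed.

Lemma connected_component (W : {set T}) u : u \in W -> connected e (component W u).
Proof.
move=> uW; set C := component W u.
suff from_u v : v \in C -> connect [rel x y | [&& x \in C, y \in C & e x y]] u v.
  apply/forall_inP=> v vC; apply/forall_inP=> w wC.
  apply: connect_trans (from_u w wC); rewrite (sym_connect_sym _) ?from_u //.
  by move=> x y /=; rewrite e_sym andbCA.
rewrite inE => /andP[_ /connectP[s us ->]] {v}.
have along t v : v \in C -> path [rel x y | [&& x \in W, y \in W & e x y]] v t ->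
    connect [rel x y | [&& x \in C, y \in C & e x y]] v (last v t).
  elim: t v => [|w t IHt] v vC; first by rewrite connect0.
  move=> /= /andP[/and3P[vW wW vw] wt].
  have wC : w \in C by apply: component_closed vC wW vw.
  by apply: connect_trans (connect1 _) (IHt w wC wt); rewrite /= vC wC.
exact: along (component_refl uW) us.
Qed.

Lemma connected_closed_sub (Q C : {set T}) u : connected e Q -> u \in Q -> u \in C ->
  (forall v w, v \in C -> w \in Q -> e v w -> w \in C) -> Q \subset C.
Proof.
move=> cQ uQ uC closed; apply/subsetP=> v vQ.
have [s [us <- sQ]] := connectedP cQ uQ vQ.
elim: s u us sQ uC {uQ} => //= w s IHs u /andP[uw ws] sQ uC.
apply: (IHs w) => // [z zs|]; first by apply: sQ; rewrite inE zs orbT.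
by apply: closed uC _ uw; apply: sQ; rewrite inE eqxx.
Qed.

Lemma connected_sub_component (W Q : {set T}) u v : connected e Q -> Q \subset W ->
  v \in Q -> v \in component W u -> Q \subset component W u.
Proof.
move=> cQ QW vQ vC; apply: (connected_closed_sub cQ vQ vC) => x y xC yQ.
exact: component_closed xC (subsetP QW _ yQ).
Qed.

Lemma small_of_disjoint (W Q Q0 : {set T}) : Q \subset W -> Q0 \subset W ->
  #|W| < 2 * #|Q0| -> [disjoint Q & Q0] -> 2 * #|Q| <= #|W|.
Proof.
move=> QW Q0W big dis.
have : #|Q :|: Q0| <= #|W| by apply: subset_leq_card; rewrite subUset QW.
rewrite cardsU (disjoint_setI0 dis) cards0; move: big; clear; lia.
Qed.

End Components.

(** Pigeonhole: the h residue classes partition W. *)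
Lemma small_residue (T : finType) (W : {set T}) (f : T -> nat) (h : nat) : 0 < h ->
  exists2 c, c < h & h * #|[set v in W | f v %% h == c]| <= #|W|.
Proof.
move=> h0; have [/existsP[c]|] := boolP [exists c : 'I_h, h * #|[set v in W | f v %% h == c]| <= #|W|].
  by exists c.
move=> /existsPn big; exfalso.
have sumE : \sum_(c < h) #|[set v in W | f v %% h == c]| = #|W|.
  rewrite -sum1_card (partition_big (fun v => Ordinal (ltn_pmod (f v) h0)) xpredT) //=.
  by apply: eq_bigr => c _; rewrite -sum1_card; apply: eq_bigl => v; rewrite inE.
have : \sum_(c < h) #|W|.+1 <= \sum_(c < h) h * #|[set v in W | f v %% h == c]|.
  by apply: leq_sum => c _; rewrite ltnNge big.
by rewrite -big_distrr /= sumE sum_nat_const card_ord leq_pmul2l // ltnn.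
Qed.

(** * Balanced separators and division into small overlapping pieces *)

Section Division.

Variables (T : finType) (e : rel T) (S : T -> seq point) (N : nat).
Hypothesis e_sym : symmetric e.
Hypothesis eS : grid_strings e S N.

Definition max_degree (W : {set T}) (d : nat) : Prop :=
  forall v, v \in W -> #|[set w in W | e v w]| <= d.

Lemma max_degree_sub (V W : {set T}) d : V \subset W -> max_degree W d -> max_degree V d.
Proof.
move=> VW dW v vV; apply: leq_trans (dW v (subsetP VW _ vV)).
apply/subset_leq_card/subsetP=> w; rewrite !inE => /andP[wV ->].
by rewrite (subsetP VW).
Qed.

(** Remove a sparse residue class L of levels, at most |W|/h vertices. If a majority piece survives,
    it lies in one slab between consecutive removed levels, and only that slab needs to be separated
    further. *)
Lemma connected_separator (W : {set T}) (d h : nat) :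
  0 < h -> max_degree W d -> connected e W ->
  exists X : {set T}, [/\ X \subset W, h * #|X| <= #|W| + h * (4 * (d.+1 * h.+2))
    & forall Q : {set T}, Q \subset W :\: X -> connected e Q -> 2 * #|Q| <= #|W|].
Proof.
move=> h0 dW cW.
have [->|/set0Pn[r0 r0W]] := eqVneq W set0.
  exists set0; rewrite sub0set cards0 muln0; split=> // Q.
  by rewrite setD0 subset0 => /eqP-> _; rewrite cards0.
(* The root is chosen as a vertex whose string reaches the leftmost column used by W. *)
pose P x := [exists w in W, has (fun p : point => p.1 == x) (S w)].
have exP : exists x, P x.
  exists (head (0, 0) (S r0)).1; apply/exists_inP; exists r0 => //.
  apply/hasP; exists (head (0, 0) (S r0)) => //.
  by have := strings_neq0 eS r0; case: (S r0) => //= a s _; rewrite inE eqxx.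
case: (ex_minnP exP) => x /exists_inP[r rW /hasP[o o_r /eqP ox]] min.
have o_left v p : v \in W -> p \in S v -> o.1 <= p.1.
  move=> vW pv; rewrite ox; apply: min; apply/exists_inP; exists v => //.
  by apply/hasP; exists p.
have [lev [lev0 levS lev_adj]] := connected_levels cW rW.
have [c ch] := small_residue W lev h0; set L := [set v in W | _] => Lsmall.
have LW : L \subset W by apply/subsetP=> v; rewrite inE => /andP[].
(* The index of the slab containing v: the shift by h - c makes it jump exactly on arriving at a
   level congruent to c, and such levels form L. *)
pose b v := (lev v + (h - c)) %/ h.
have b_adj u v : u \in W :\: L -> v \in W :\: L -> e u v -> b u = b v.
  have step y : y \notin L -> y \in W -> forall k, (lev y) = k.+1 -> (k + (h - c)) %/ h = b y.
    rewrite inE => + yW k yk; rewrite yW /b yk addSn divnS //= => ny.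
    rewrite (_ : h %| _ = false) //; apply/negbTE; apply: contra ny => hk.
    have kh : k.+1 + h = (k + (h - c)).+1 + c by move: ch; clear; lia.
    by rewrite -(modnDr k.+1 h) kh -modnDml (eqP hk) add0n modn_small.
  rewrite !in_setD => /andP[uL uW] /andP[vL vW] uv.
  have := lev_adj _ _ uW vW uv; rewrite leq_eqVlt => /orP[/eqP luv|].
    by rewrite -(step v vL vW _ luv).
  rewrite ltnS => lvu; rewrite e_sym in uv; have := lev_adj _ _ vW uW uv.
  rewrite leq_eqVlt => /orP[/eqP luv|]; first by rewrite -(step u uL uW _ luv).
  by rewrite ltnS => luv; rewrite /b (_ : lev u = lev v) //; apply/eqP; rewrite eqn_leq luv.
have [/existsP[Q0 /and3P[Q0W cQ0 Q0big]]|small] := boolP [exists Q0 : {set T},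
    [&& Q0 \subset W :\: L, connected e Q0 & #|W| < 2 * #|Q0|]]; last first.
  exists L; split=> // [|Q QW cQ]; first by apply: leq_trans Lsmall (leq_addr _ _).
  by move/existsPn/(_ Q): small; rewrite QW cQ /= -leqNgt.
have [u0 u0Q] : exists u, u \in Q0.
  by apply/set0Pn; apply: contraTneq Q0big => ->; rewrite cards0.
pose K := [set v in W :\: L | b v == b u0].
have KWL : K \subset W :\: L by apply/subsetP=> v; rewrite inE => /andP[].
have KW : K \subset W by apply: subset_trans KWL (subsetDl _ _).
(* Truncated subtraction is harmless: it matters only for index 0, where all levels are below c. *)
have slab v : v \in K -> b u0 * h - (h - c) <= lev v < b u0 * h - (h - c) + h.
  rewrite inE => /andP[_ /eqP <-]; rewrite /b.
  have := divn_eq (lev v + (h - c)) h; have := ltn_pmod (lev v + (h - c)) h0.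
  by move: ch; clear; lia.
have [X1 /andP[X1K X1small] sepX] := slab_separator eS KW dW rW lev0 levS lev_adj e_sym slab o_r o_left.
exists (L :|: X1); split.
- by rewrite subUset LW (subset_trans X1K KW).
- apply: leq_trans (_ : h * (#|L| + #|X1|) <= _).
    by rewrite leq_pmul2l // leq_card_setU.
  by rewrite mulnDr leq_add // leq_pmul2l.
move=> Q QX cQ; have QW : Q \subset W :\: L.
  by apply: subset_trans QX _; apply: setDS; apply: subsetUl.
have const (Q' : {set T}) u : Q' \subset W :\: L -> connected e Q' -> u \in Q' -> b u = b u0 -> Q' \subset K.
  move=> Q'W cQ' uQ' bu; apply: (connected_closed_sub cQ' uQ').
    by rewrite inE (subsetP Q'W) //= bu.
  move=> v w; rewrite inE => /andP[vW /eqP bv] /(subsetP Q'W) wW vw.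
  by rewrite inE wW /= -(b_adj _ _ vW wW vw) bv.
(* A piece disjoint from the majority piece is small anyway; one that meets it lies in the same
   slab. *)
have [dis|/pred0Pn[u /andP[/= uQ uQ0]]] := boolP [disjoint Q & Q0].
  apply: small_of_disjoint Q0big dis; first exact: subset_trans QW (subsetDl _ _).
  exact: subset_trans Q0W (subsetDl _ _).
have Q0K := const _ _ Q0W cQ0 u0Q erefl.
have /andP[_ /eqP bu] : (u \in W :\: L) && (b u == b u0) by have := subsetP Q0K _ uQ0; rewrite inE.
have QK := const _ _ QW cQ uQ bu.
apply: leq_trans (sepX Q _ cQ) (subset_leq_card KW).
apply/subsetP=> v vQ; rewrite inE (subsetP QK) // andbT.
by have := subsetP QX _ vQ; rewrite !inE negb_or => /andP[/andP[]].
Qed.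

(** At most one component of W can hold a majority piece, so separating that component is enough. *)
Lemma separator (W : {set T}) (d h : nat) : 0 < h -> max_degree W d ->
  exists X : {set T}, [/\ X \subset W, h * #|X| <= #|W| + h * (4 * (d.+1 * h.+2))
    & forall Q : {set T}, Q \subset W :\: X -> connected e Q -> 2 * #|Q| <= #|W|].
Proof.
move=> h0 dW.
have [/existsP[Q0 /and3P[Q0W cQ0 Q0big]]|small] := boolP [exists Q0 : {set T},
    [&& Q0 \subset W, connected e Q0 & #|W| < 2 * #|Q0|]]; last first.
  exists set0; rewrite sub0set cards0 muln0; split=> // Q; rewrite setD0 => QW cQ.
  by move/existsPn/(_ Q): small; rewrite QW cQ /= -leqNgt.
have [u0 u0Q] : exists u, u \in Q0.
  by apply/set0Pn; apply: contraTneq Q0big => ->; rewrite cards0.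
have u0W := subsetP Q0W _ u0Q; have CW := component_sub e W u0.
have Q0C := connected_sub_component cQ0 Q0W u0Q (component_refl e u0W).
have [X [XC Xsmall sepX]] :=
  connected_separator h0 (max_degree_sub CW dW) (connected_component e_sym u0W).
exists X; split; first exact: subset_trans XC CW.
  by apply: leq_trans Xsmall _; rewrite leq_add2r subset_leq_card.
move=> Q QX cQ; have QW : Q \subset W by apply: subset_trans QX (subsetDl _ _).
have [dis|/pred0Pn[u /andP[/= uQ uQ0]]] := boolP [disjoint Q & Q0].
  exact: small_of_disjoint Q0big dis.
have QC := connected_sub_component cQ QW uQ (subsetP Q0C _ uQ0).
apply: leq_trans (sepX Q _ cQ) (subset_leq_card CW).
apply/subsetP=> v vQ; rewrite inE (subsetP QC) // andbT.
by have := subsetP QX _ vQ; rewrite inE => /andP[].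
Qed.

(** Take a largest union A of components with at most half of |W|. If the rest exceeds 3/4 of |W|,
    then A is below 1/4. By maximality, adding any further component C passes one half, so C lies
    between 1/4 and 1/2 and can serve instead. *)
Lemma balanced_split (W R : {set T}) : R \subset W ->
  (forall Q : {set T}, Q \subset R -> connected e Q -> 2 * #|Q| <= #|W|) ->
  exists A : {set T}, [/\ A \subset R, forall u v, u \in A -> v \in R :\: A -> ~~ e u v,
    4 * #|A| <= 3 * #|W| & 4 * #|R :\: A| <= 3 * #|W| ].
Proof.
move=> RW small.
pose closed (A : {set T}) := (A \subset R) && [forall u in A, forall v in R :\: A, ~~ e u v].
have closedP A : closed A -> forall u v, u \in A -> v \in R :\: A -> ~~ e u v.
  by move=> /andP[_ /forall_inP cA] u v uA vA; apply: (forall_inP (cA u uA)).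
have closed_comp u : u \in R -> closed (component e R u).
  move=> uR; rewrite /closed component_sub; apply/forall_inP=> v vC.
  apply/forall_inP=> w; rewrite in_setD => /andP[wC wR].
  by apply: contra wC; apply: component_closed vC wR.
have P0 : closed set0 && (2 * #|@set0 T| <= #|W|).
  by rewrite /closed sub0set cards0 /= andbT; apply/forall_inP=> u; rewrite inE.
case: (@arg_maxnP _ (set0 : {set T}) (fun A => closed A && (2 * #|A| <= #|W|)) (fun A => #|A|) P0) => A /andP[cA A2] maxA.
have AR : A \subset R by case/andP: cA.
have cardR : #|R :\: A| = #|R| - #|A| by rewrite cardsD (setIidPr AR).
have RA := subset_leq_card AR; have RW' := subset_leq_card RW.
have [Bsmall|Bbig] := leqP (4 * #|R :\: A|) (3 * #|W|).
  exists A; split=> //; first exact: closedP.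
  by move: A2; clear; lia.
have [u uB] : exists u, u \in R :\: A.
  by apply/set0Pn; apply: contraTneq Bbig => ->; rewrite cards0.
move: uB; rewrite in_setD => /andP[uA uR].
have cC := closed_comp u uR; set C := component e R u in cC.
have C2 : 2 * #|C| <= #|W|.
  by apply: small; [exact: component_sub | exact: connected_component].
have CR : C \subset R by exact: component_sub.
have cardRC : #|R :\: C| = #|R| - #|C| by rewrite cardsD (setIidPr CR).
have RC := subset_leq_card CR.
exists C; split=> //; first exact: closedP.
  by move: C2; clear; lia.
have AC2 : #|W| < 2 * #|A :|: C|.
  have cAC : closed (A :|: C).
    rewrite /closed subUset AR CR; apply/forall_inP=> v; rewrite in_setU => vAC.
    apply/forall_inP=> w; rewrite in_setD in_setU negb_or => /andP[/andP[wA wC] wR].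
    case/orP: vAC => [vA|vC]; first by apply: (closedP A) vA _ => //; rewrite in_setD wA.
    by apply: (closedP C) vC _ => //; rewrite in_setD wC.
  rewrite ltnNge; apply/negP=> AC2; have := maxA (A :|: C).
  rewrite cAC AC2 => /(_ isT); apply/negP; rewrite -ltnNge.
  apply/proper_card/properP; split; first exact: subsetUl.
  by exists u => //; rewrite in_setU component_refl ?orbT.
have := leq_card_setU A C.
move: AC2 Bbig A2 C2 RA RC RW' cardR cardRC; clear => /= ? ? ? ? ? ? ? ? ? [? _]; lia.
Qed.

(** Split recursively into A with X and B with X. While |W| > r, the choice of h and the bound by a
    * r give M|X| <= |W|. As M >= 8, both parts have at most 3/4 + 1/8 = 7/8 of |W|, so k rounds
    reach size r. *)
Lemma division (d h M a r k : nat) (W : {set T}) :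
  8 <= M -> 2 * k <= M -> h = M * a.+1 -> h * (4 * (d.+1 * h.+2)) <= a * r ->
  max_degree W d -> #|W| * 7 ^ k <= r * 8 ^ k ->
  exists Vs : seq {set T},
    [/\ forall V, V \in Vs -> V \subset W /\ #|V| <= r,
        forall u v, u \in W -> v \in W -> e u v ->
          exists V, [/\ V \in Vs, u \in V & v \in V]
      & M * \sum_(V <- Vs) #|V| <= (M + 2 * k) * #|W| ].
Proof.
move=> M8 + hM har; elim: k W => [|k IHk] W kM dW Wk.
  exists [:: W]; split=> [V||]; last by rewrite big_seq1 muln0 addn0.
    by rewrite inE => /eqP->; split=> //; rewrite !muln1 in Wk.
  by move=> u v uW vW _; exists W; rewrite inE.
have [Wr|rW] := leqP #|W| r.
  exists [:: W]; split=> [V||]; last by rewrite big_seq1 leq_mul2r leq_addr orbT.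
    by rewrite inE => /eqP->.
  by move=> u v uW vW _; exists W; rewrite inE.
have h0 : 0 < h by rewrite hM muln_gt0 /=; case: (M) M8.
have [X [XW Xh sepX]] := separator h0 dW.
have MX : M * #|X| <= #|W|.
  have : h * #|X| <= a.+1 * #|W|.
    apply: leq_trans Xh _; rewrite mulSn leq_add2l; apply: leq_trans har _.
    by rewrite leq_mul2l ltnW ?orbT.
  by rewrite hM mulnAC [M * _ * _]mulnC leq_pmul2l.
have [A [AR sepA A4 B4]] := balanced_split (subsetDl W X) sepX.
set R := W :\: X in AR sepA A4 B4 *; set B := R :\: A in B4.
have RW : R \subset W by exact: subsetDl.
have BR : B \subset R by exact: subsetDl.
have cardAB : #|A| + #|B| + #|X| = #|W|.
  have := subset_leq_card AR; have := subset_leq_card XW.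
  rewrite /B cardsD (setIidPr AR) /R cardsD (setIidPr XW); clear; lia.
have X8 : 8 * #|X| <= #|W| by apply: leq_trans MX; rewrite leq_mul2r M8 orbT.
have part (V : {set T}) : V \subset R -> 4 * #|V| <= 3 * #|W| -> exists Vs : seq {set T},
    [/\ forall V', V' \in Vs -> V' \subset W /\ #|V'| <= r,
        forall u v, u \in V :|: X -> v \in V :|: X -> e u v ->
          exists V', [/\ V' \in Vs, u \in V' & v \in V']
      & M * \sum_(V' <- Vs) #|V'| <= (M + 2 * k) * (#|V| + #|X|) ].
  move=> VR V4; have VXW : V :|: X \subset W by rewrite subUset (subset_trans VR).
  have cVX : #|V :|: X| <= #|V| + #|X| by exact: leq_card_setU.
  have [||Vs [Vs1 Vs2 Vs3]] := IHk (V :|: X) _ (max_degree_sub VXW dW).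
  - by move: kM; clear; lia.
  - have V7 : 8 * #|V :|: X| <= 7 * #|W| by move: V4 X8 cVX; clear; lia.
    have := leq_mul (leqnn (7 ^ k)) V7; move: Wk; rewrite !expnS; clear; nia.
  exists Vs; split=> //.
    by move=> V' /Vs1[V'V ?]; split=> //; apply: subset_trans V'V VXW.
  by apply: leq_trans Vs3 _; rewrite leq_mul2l cVX orbT.
have [Vs [Vs1 Vs2 Vs3]] := part A AR A4.
have [Us [Us1 Us2 Us3]] := part B BR B4.
exists (Vs ++ Us); split.
- by move=> V; rewrite mem_cat => /orP[/Vs1|/Us1].
- have cover u : u \in W -> [|| u \in X, u \in A | u \in B].
    by move=> uW; rewrite /B /R !inE uW; case: (u \in X); case: (u \in A).
  move=> u v uW vW uv.
  have inV : u \in A :|: X -> v \in A :|: X -> exists V, [/\ V \in Vs ++ Us, u \in V & v \in V].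
    move=> uA vA; have [V [VVs uV vV]] := Vs2 u v uA vA uv.
    by exists V; rewrite mem_cat VVs.
  have inU : u \in B :|: X -> v \in B :|: X -> exists V, [/\ V \in Vs ++ Us, u \in V & v \in V].
    move=> uB vB; have [V [VUs uV vV]] := Us2 u v uB vB uv.
    by exists V; rewrite mem_cat VUs orbT.
  have [uX|uA|uB] := or3P (cover u uW); have [vX|vA|vB] := or3P (cover v vW).
  all: try by apply: inV; rewrite in_setU ?uX ?uA ?vX ?vA ?orbT.
  all: try by apply: inU; rewrite in_setU ?uX ?uB ?vX ?vB ?orbT.
  + by have := sepA _ _ uA vB; rewrite uv.
  + by have := sepA _ _ vA uB; rewrite e_sym uv.
rewrite big_cat /= mulnDr; apply: leq_trans (leq_add Vs3 Us3) _.
(* Both parts contain X, so their sizes add up to |W| + |X|. Since 2k <= M and M|X| <= |W|, (M +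
   2k)|X| is at most 2|W|, the growth allowed for one round. *)
move: kM MX; rewrite -cardAB; clear; nia.
Qed.

End Division.

(** * Stars and spanners *)

Section Spanners.

Variables (T : finType) (e : rel T).
Hypothesis e_sym : symmetric e.

Definition undirected (E : {set T * T}) : rel T :=
  fun u v => ((u, v) \in E) || ((v, u) \in E).

Definition joined (E : {set T * T}) (t : nat) (u v : T) : Prop :=
  exists s, [/\ path (undirected E) u s, last u s = v & size s <= t].

Lemma undirected_sym E : symmetric (undirected E).
Proof. by move=> u v; rewrite /undirected orbC. Qed.

Lemma joined_trans E s t u v w : joined E s u v -> joined E t v w -> joined E (s + t) u w.
Proof.
move=> [p [up pv ps]] [q [vq qw qt]]; exists (p ++ q).
by rewrite cat_path last_cat pv up size_cat; split=> //; apply: leq_add.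
Qed.

Lemma joined_sym E t u v : joined E t u v -> joined E t v u.
Proof.
move=> [p [up pv pt]]; exists (rev (belast u p)).
rewrite -pv rev_path size_rev size_belast; split=> //; last first.
  by case: p {up pv pt} => //= w p; rewrite rev_cons last_rcons.
by rewrite (eq_path (e' := undirected E)) // => x y; rewrite undirected_sym.
Qed.

Lemma joined_sub (E F : {set T * T}) s t u v :
  E \subset F -> s <= t -> joined E s u v -> joined F t u v.
Proof.
move=> EF st [p [up pv ps]]; exists p; split=> //; last exact: leq_trans ps st.
apply: sub_path up => x y.
by rewrite /undirected => /orP[] /(subsetP EF)->; rewrite ?orbT.
Qed.

(** Only edges inside W have to be spanned, but the spanning walks may leave W. Each pair in E
    stands for an undirected edge. *)
Definition has_spanner (t : nat) (W : {set T}) (m : nat) : Prop :=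
  exists E : {set T * T}, [/\ forall p, p \in E -> e p.1 p.2, #|E| <= m &
    forall u v, u \in W -> v \in W -> e u v -> joined E t u v].

Lemma has_spanner_leq t W m n : m <= n -> has_spanner t W m -> has_spanner t W n.
Proof.
by move=> mn [E [Ee Em Ej]]; exists E; split=> //; apply: leq_trans Em mn.
Qed.

Lemma complete_spanner t (W : {set T}) : 0 < t -> has_spanner t W (#|W| * #|W|).
Proof.
move=> t0; exists [set p in setX W W | e p.1 p.2]; split=> [p||u v uW vW uv].
- by rewrite inE => /andP[].
- by rewrite -cardsX; apply: subset_leq_card; apply/subsetP=> p; rewrite inE => /andP[].
exists [:: v]; split=> //=.
by rewrite /undirected !inE uW vW uv.
Qed.

Lemma union_spanner t (Vs : seq {set T}) (m : {set T} -> nat) :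
  (forall V, V \in Vs -> has_spanner t V (m V)) ->
  exists E : {set T * T}, [/\ forall p, p \in E -> e p.1 p.2,
    #|E| <= \sum_(V <- Vs) m V &
    forall V u v, V \in Vs -> u \in V -> v \in V -> e u v -> joined E t u v].
Proof.
elim: Vs => [|V Vs IHVs] sp.
  by exists set0; rewrite big_nil cards0; split=> // p; rewrite inE.
have [E [Ee Em Ej]] := sp V (mem_head _ _).
have [|F [Fe Fm Fj]] := IHVs; first by move=> U UVs; apply: sp; rewrite inE UVs orbT.
exists (E :|: F); split=> [p||U u v].
- by rewrite inE => /orP[/Ee|/Fe].
- by rewrite big_cons; apply: leq_trans (leq_card_setU _ _) (leq_add Em Fm).
rewrite inE => /orP[/eqP->|UVs] uU vU uv.
  by apply: joined_sub (Ej u v uU vU uv); rewrite ?subsetUl.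
by apply: joined_sub (Fj U u v UVs uU vU uv); rewrite ?subsetUr.
Qed.

(** Choose centers X and leaves K with |K| maximal: a vertex with d neighbours outside K would be a
    further center. Centers need not belong to K. *)
Lemma greedy_stars (W : {set T}) (d : nat) : 0 < d ->
  exists X K : {set T}, [/\ K \subset W, #|X| * d <= #|K|,
    forall u, u \in K -> exists2 c, c \in X & e u c &
    forall w, w \in W -> #|[set v in W :\: K | e w v]| < d].
Proof.
move=> d0.
pose P (XK : {set T} * {set T}) := [&& XK.2 \subset W, #|XK.1| * d <= #|XK.2| &
  [forall u in XK.2, exists c in XK.1, e u c]].
have P0 : P (set0, set0).
  by rewrite /P sub0set !cards0 /=; apply/forall_inP=> u; rewrite inE.
case: (@arg_maxnP _ (set0, set0) P (fun XK => #|XK.2|) P0) => -[X K] /and3P[/= KW Xd dom] maxK.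
exists X, K; split=> //; first by move=> u uK; apply/exists_inP/(forall_inP dom).
move=> w wW; rewrite ltnNge; apply/negP=> dw; set L := [set v in _ | _] in dw.
have KL : #|K :|: L| = #|K| + #|L|.
  rewrite cardsU (_ : K :&: L = set0) ?cards0 ?subn0 //.
  by apply/setP=> v; rewrite !inE; case: (v \in K).
have PXL : P (w |: X, K :|: L).
  apply/and3P; split=> /=.
  - by rewrite subUset KW; apply/subsetP=> v; rewrite !inE => /andP[/andP[]].
  - rewrite KL cardsU1 mulnDl addnC leq_add //; apply: leq_trans dw.
    by rewrite -[leqRHS]mul1n leq_mul2r leq_b1 orbT.
  apply/forall_inP=> u; rewrite in_setU => /orP[/(forall_inP dom)/exists_inP[c cX uc]|].
    by apply/exists_inP; exists c => //; rewrite in_setU cX orbT.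
  rewrite inE => /andP[_ wu]; apply/exists_inP; exists w; first by rewrite setU11.
  by rewrite e_sym.
have := maxK _ PXL; rewrite /= KL -[leqRHS]addn0 leq_add2l leqn0 => /eqP L0.
by move: d0 dw; rewrite L0; case: (d).
Qed.

(* For [u] in [K] with center [c], and a neighbour [v] outside [K] attached to some [u'] in [K]
   with center [c'], the detour is v, u', c', then a stored walk of length at most 4 from c' to c
   (one exists, namely c', u', v, u, c), then u. *)
Lemma star_spanner (W K X : {set T}) : K \subset W ->
  (forall u, u \in K -> exists2 c, c \in X & e u c) ->
  exists E : {set T * T}, [/\ forall p, p \in E -> e p.1 p.2,
    #|E| <= #|W| + 4 * (#|X| * #|X|) &
    forall u v, u \in K -> v \in W -> e u v -> joined E 7 u v].
Proof.
move=> KW dom.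
(* Lazy steps pad walks of length at most 4 to exactly four steps, so a triple of inner vertices
   encodes them. *)
pose lazy u v := (u == v) || e u v.
(* A center of v if v lies in K, and otherwise a neighbour of v in K. *)
pose f v := odflt v (if v \in K then [pick c in X | e v c] else [pick u in K | e v u]).
have fK u : u \in K -> f u \in X /\ e u (f u).
  move=> uK; rewrite /f uK; case: pickP => [c /andP[]//|nc].
  by have [c cX uc] := dom u uK; have := nc c; rewrite /= cX uc.
have fU u v : u \in K -> v \notin K -> e v u -> f v \in K /\ e v (f v).
  move=> uK vK vu; rewrite /f (negbTE vK); case: pickP => [c /andP[]//|nc].
  by have := nc u; rewrite /= uK vu.
pose good (p : T * T) (t : T * T * T) :=
  [&& lazy p.1 t.1.1, lazy t.1.1 t.1.2, lazy t.1.2 t.2 & lazy t.2 p.2].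
pose m (p : T * T) := odflt (p.2, p.2, p.2) [pick t | good p t].
pose F := [set (v, f v) | v in W] :|: ([set (p.1, (m p).1.1) | p in setX X X]
  :|: [set ((m p).1.1, (m p).1.2) | p in setX X X]
  :|: [set ((m p).1.2, (m p).2) | p in setX X X] :|: [set ((m p).2, p.2) | p in setX X X]).
(* The lazy steps and the default values of f and m may put non-edges into F; they are discarded
   here. *)
pose E := [set p in F | e p.1 p.2].
have join1 u v : (u, v) \in F -> lazy u v -> joined E 1 u v.
  move=> uvF /orP[/eqP->|uv]; first by exists [::].
  exists [:: v]; split=> //=.
  by rewrite /undirected (_ : (u, v) \in E) // inE uvF uv.
have joinX c c' t : c \in X -> c' \in X -> good (c, c') t -> joined E 4 c c'.
  move=> cX cX' gt; have := erefl (m (c, c')); rewrite {2}/m.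
  case: pickP => [t' gt' /= mE|/(_ t)]; last by rewrite gt.
  have ccX : (c, c') \in setX X X by rewrite inE cX cX'.
  case/and4P: gt' => /= l1 l2 l3 l4.
  apply: (@joined_trans E 1 3 _ t'.1.1).
    apply: join1 l1; rewrite -mE; apply/setUP; right; do 3!(apply/setUP; left).
    exact: (imset_f (fun p => (p.1, (m p).1.1)) ccX).
  apply: (@joined_trans E 1 2 _ t'.1.2).
    apply: join1 l2; rewrite -mE; apply/setUP; right; do 2!(apply/setUP; left).
    by apply/setUP; right; exact: (imset_f (fun p => ((m p).1.1, (m p).1.2)) ccX).
  apply: (@joined_trans E 1 1 _ t'.2).
    apply: join1 l3; rewrite -mE; apply/setUP; right; apply/setUP; left.
    by apply/setUP; right; exact: (imset_f (fun p => ((m p).1.2, (m p).2)) ccX).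
  apply: join1 l4; rewrite -mE; apply/setUP; right; apply/setUP; right.
  exact: (imset_f (fun p => ((m p).2, p.2)) ccX).
have joinf v : v \in W -> e v (f v) -> joined E 1 v (f v).
  move=> vW vf; apply: join1; last by rewrite /lazy vf orbT.
  by rewrite in_setU imset_f.
exists E; split=> [p||u v uK vW uv].
- by rewrite inE => /andP[].
- apply: leq_trans (_ : #|F| <= _); first by apply/subset_leq_card/subsetP=> p; rewrite inE => /andP[].
  apply: leq_trans (leq_card_setU _ _) (leq_add (leq_imset_card _ _) _).
  have cX (g : T * T -> T * T) : #|g @: setX X X| <= #|X| * #|X|.
    by rewrite -cardsX leq_imset_card.
  have cardU (A B : {set T * T}) a b : #|A| <= a -> #|B| <= b -> #|A :|: B| <= a + b.
    by move=> Aa Bb; apply: leq_trans (leq_card_setU A B) _; apply: leq_add.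
  rewrite !mulSn mul0n addn0 !addnA.
  by do 3!(apply: (cardU _ _ _ _ _ _); last exact: cX); apply: cX.
have [cX uc] := fK u uK; have uW := subsetP KW _ uK.
have cu : e (f u) u by rewrite e_sym.
apply: (@joined_trans E 1 6 _ (f u)); first exact: joinf.
have [vK|vK] := boolP (v \in K).
  have [cX' vc] := fK v vK.
  apply: (@joined_sub E E 5) => //; apply: (@joined_trans E 4 1 _ (f v)).
    by apply: (joinX _ _ (u, v, f v)); rewrite // /good /lazy /= cu uv vc eqxx !orbT.
  by apply: joined_sym; apply: joinf.
have [uK' vu'] : f v \in K /\ e v (f v) by apply: (fU u) => //; rewrite e_sym.
have [cX' uc'] := fK _ uK'.
apply: (@joined_trans E 4 2 _ (f (f v))).
  by apply: (joinX _ _ (u, v, f v)); rewrite // /good /lazy /= cu uv vu' uc' !orbT.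
apply: joined_sym; apply: (@joined_trans E 1 1 _ (f v)); first exact: joinf.
by apply: joinf => //; apply: (subsetP KW).
Qed.

End Spanners.

(** * Recursion *)

(** Bernoulli's inequality for (1 + 1/a)^n with denominators cleared. *)
Lemma bernoulli_nat (a n : nat) : a ^ n * (a + n) <= a.+1 ^ n * a.
Proof. by elim: n => [|n IHn]; rewrite ?addn0 // !expnS; nia. Qed.

Lemma double_le_exp (a : nat) : 0 < a -> 2 * a ^ a <= a.+1 ^ a.
Proof.
by move=> a0; rewrite -(leq_pmul2r a0) mulnAC mulnC mul2n -addnn bernoulli_nat.
Qed.

Lemma sqr_le_exp (c x a b d : nat) :
  c <= 2 ^ a -> x <= 2 ^ b -> a + b + b <= d -> c * x ^ 2 <= 2 ^ d.
Proof.
move=> ca xb abd; apply: leq_trans (_ : 2 ^ (a + b + b) <= _); last by rewrite leq_exp2l.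
by rewrite !expnD -mulnn mulnA leq_mul // leq_mul.
Qed.

Lemma sqr_le_exp_step c k m : c * (30 + k) ^ 2 <= 2 ^ m -> c * (30 + k.+1) ^ 2 <= 2 ^ m.+1.
Proof.
move=> le_k; rewrite [2 ^ m.+1]expnS; apply: leq_trans (leq_mul (leqnn 2) le_k).
by rewrite mulnCA leq_mul2l -!mulnn; apply/orP; right; clear; nia.
Qed.

(** At n = 30 the left side is at most 2^12 * 2^10 <= 2^25, and from then on n^2 at most doubles
    when n grows by one. *)
Lemma quadratic_le_exp c n : c <= 2 ^ 12 -> 30 <= n -> c * n ^ 2 <= 2 ^ (n - 5).
Proof.
move=> c12 n30; have [k ->] : exists k, n = 30 + k by exists (n - 30); rewrite subnKC.
elim: {n n30} k => [|k IHk]; first exact: (@sqr_le_exp c 30 12 5 25 c12).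
have -> : 30 + k.+1 - 5 = (30 + k - 5).+1 by lia.
exact: sqr_le_exp_step.
Qed.

Section Recursion.

Variables (T : finType) (e : rel T) (S : T -> seq point) (N : nat).
Hypothesis e_sym : symmetric e.
Hypothesis eS : grid_strings e S N.

(** With |W| <= p^10 and stars of p^6 leaves there are at most p^4 centers, hence at most p^8 < |W|
    pairs of centers, and the stars cost 5|W|. The rest has degree at most p^6 and is divided with h
    = p into pieces of size at most p^8; the overlap of the pieces accounts for b. *)
Lemma spanner_step (p M a b k : nat) (W : {set T}) :
  p = M * 32 -> 8 <= M -> 2 * k <= M -> p ^ 10 * 7 ^ k <= p ^ 8 * 8 ^ k ->
  a * (2 * k) <= M * b -> p ^ 8 < #|W| <= p ^ 10 ->
  (forall V : {set T}, #|V| <= p ^ 8 -> has_spanner e 7 V (a * #|V|)) ->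
  has_spanner e 7 W ((5 + a + b) * #|W|).
Proof.
move=> pM M8 kM pk ab /andP[pW Wp] small.
have p2 : 2 <= p by rewrite pM; move: M8; clear; lia.
have p0 : 0 < p by exact: ltnW.
have p6 : 0 < p ^ 6 by rewrite expn_gt0 p0.
have [X [K [KW Xd dom degU]]] := greedy_stars e_sym W (d := p ^ 6) p6.
have X4 : #|X| <= p ^ 4.
  rewrite -(leq_pmul2r p6) -expnD.
  exact: leq_trans Xd (leq_trans (subset_leq_card KW) Wp).
have X8 : #|X| * #|X| <= #|W|.
  by apply: leq_trans (leq_mul X4 X4) _; rewrite -expnD ltnW.
set U := W :\: K; have UW : U \subset W by exact: subsetDl.
have dU : max_degree e U (p ^ 6).
  by move=> v vU; apply: ltnW; apply: degU; apply: (subsetP UW).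
(* The constant 31 comes from p = M * 32 = M * (31 + 1), the form of h in [division]. *)
have har : p * (4 * ((p ^ 6).+1 * p.+2)) <= 31 * p ^ 8.
  have -> : p ^ 8 = p * (p * p ^ 6) by rewrite -!expnS.
  by move: (p ^ 6) p6 p2; clear; nia.
have Uk : #|U| * 7 ^ k <= p ^ 8 * 8 ^ k.
  by apply: leq_trans pk; rewrite leq_mul2r (leq_trans (subset_leq_card UW) Wp) orbT.
have [Vs [Vsmall Vcover Vsum]] := division e_sym eS M8 kM pM har dU Uk.
have [E0 [E0e E0m E0j]] := star_spanner e_sym KW dom.
have [|E1 [E1e E1m E1j]] := @union_spanner T e 7 Vs (fun V => a * #|V|).
  by move=> V /Vsmall[_ Vr]; apply: small.
exists (E0 :|: E1); split=> [q||u v uW vW uv].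
- by rewrite inE => /orP[/E0e|/E1e].
- apply: leq_trans (leq_card_setU _ _) (leq_trans (leq_add E0m E1m) _).
  rewrite -big_distrr /= !mulnDl -[leqRHS]addnA leq_add //.
    by rewrite [5 * _]mulSn leq_add2l leq_mul2l X8.
  have M0 : 0 < M by exact: leq_trans M8.
  rewrite -(leq_pmul2l M0) mulnCA; apply: leq_trans (leq_mul (leqnn a) Vsum) _.
  apply: leq_trans (leq_mul (leqnn a) (leq_mul (leqnn _) (subset_leq_card UW))) _.
  rewrite mulnA mulnDr -mulnDl [leqRHS]mulnA leq_mul2r mulnDr [M * a]mulnC leq_add2l.
  by rewrite ab orbT.
have sub0 : E0 \subset E0 :|: E1 by exact: subsetUl.
have [uK|uK] := boolP (u \in K).
  exact: joined_sub sub0 (leqnn 7) (E0j u v uK vW uv).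
have [vK|vK] := boolP (v \in K).
  by apply: joined_sym; apply: joined_sub sub0 (leqnn 7) (E0j v u vK uW _); rewrite e_sym.
have [||V [VVs uV vV]] := Vcover u v _ _ uv; rewrite ?in_setD ?uK ?vK //.
exact: joined_sub (subsetUr _ _) (leqnn 7) (E1j V u v VVs uV vV uv).
Qed.

(* [j] bounds the depth of the recursion: each round shrinks the exponent [l] by a factor 5/6. *)
Lemma spanner_bound (l0 j l : nat) (W : {set T}) : 300 <= l0 ->
  5 ^ j * l <= l0 * 6 ^ j -> #|W| <= 2 ^ l -> has_spanner e 7 W (2 ^ l0 * j.+1 * #|W|).
Proof.
move=> l0_big; have A10 : 10 <= 2 ^ l0.
  by apply: leq_trans (_ : 2 ^ 4 <= _) => //; rewrite leq_exp2l //; apply: leq_trans l0_big.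
(* Sets with at most 2^l0 vertices keep all their edges. *)
have base j' l' (V : {set T}) : l' <= l0 -> #|V| <= 2 ^ l' -> has_spanner e 7 V (2 ^ l0 * j'.+1 * #|V|).
  move=> ll Vl; apply: has_spanner_leq (complete_spanner e V (isT : 0 < 7)).
  rewrite leq_mul2r; apply/orP; right; apply: leq_trans Vl _.
  by apply: leq_trans (_ : 2 ^ l0 <= _); [rewrite leq_exp2l | rewrite leq_pmulr].
elim: j l W => [|j IHj] l W jl Wl.
  by apply: base Wl; rewrite !expn0 mul1n muln1 in jl.
have mono (V : {set T}) : has_spanner e 7 V (2 ^ l0 * j.+1 * #|V|) ->
    has_spanner e 7 V (2 ^ l0 * j.+2 * #|V|).
  by apply: has_spanner_leq; rewrite leq_mul2r leq_mul2l leqnSn !orbT.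
have [ll0|ll0] := leqP l l0; first exact: base ll0 Wl.
have [jl'|lj] := leqP (5 ^ j * l) (l0 * 6 ^ j); first by apply: mono; apply: IHj Wl.
(* As j rounds do not suffice, Bernoulli's inequality for 6/5 bounds j linearly in l. *)
have j5l : j < 5 * l.
  have := bernoulli_nat 5 j; have c5 : 0 < 5 ^ j by rewrite expn_gt0.
  move: (5 ^ j) (6 ^ j) c5 lj => x y x0 lj bj.
  have : l0 * (x * (5 + j)) < x * l * 5 by move: bj lj; clear; nia.
  have : x * (5 + j) <= l0 * (x * (5 + j)) by rewrite leq_pmull //; apply: leq_trans l0_big.
  by move: x0; clear; nia.
(* Here n is l/10 rounded up and p = 2^n, so |W| <= p^10. The pieces have exponent 8n, which is at
   most 5l/6: slightly more than 4l/5 because of the rounding. *)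
pose n := (l + 9) %/ 10; have [ln nl] : l <= 10 * n /\ 10 * n <= l + 9.
  by rewrite /n; clear; lia.
have n30 : 30 <= n by move: ll0 l0_big ln; clear; lia.
have jn : 5 ^ j * (8 * n) <= l0 * 6 ^ j.
  have n8 : 6 * (8 * n) <= 5 * l by move: nl n30; clear; lia.
  rewrite -(leq_pmul2l (isT : 0 < 6)); apply: leq_trans (_ : 5 ^ j.+1 * l <= _).
    by rewrite mulnCA [5 ^ j.+1]expnS [5 * _]mulnC -mulnA leq_mul2l n8 orbT.
  by apply: leq_trans jl _; rewrite expnS mulnCA.
have [Wn|Wn] := leqP #|W| (2 ^ (8 * n)); first by apply: mono; apply: IHj jn Wn.
(* The constant comes from 56 n (j+1) <= 56 n * 5l <= 2800 n^2, needed for [jM]. *)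
have q : 2800 * n ^ 2 <= 2 ^ (n - 5) by apply: quadratic_le_exp.
have pM : 2 ^ n = 2 ^ (n - 5) * 32.
  by rewrite -[32]/(2 ^ 5) -expnD subnK //; apply: leq_trans n30.
have M8 : 8 <= 2 ^ (n - 5).
  by apply: leq_trans (_ : 2 ^ 3 <= _) => //; rewrite leq_exp2l //; move: n30; clear; lia.
have kM : 2 * (14 * n) <= 2 ^ (n - 5).
  by apply: leq_trans q; rewrite -mulnn; move: n30; clear; nia.
(* Since 2 <= (8/7)^7, 14n rounds with factor 7/8 gain the missing p^2 = 2^(2n). *)
have pk : (2 ^ n) ^ 10 * 7 ^ (14 * n) <= (2 ^ n) ^ 8 * 8 ^ (14 * n).
  rewrite -[10]/(8 + 2) expnD -mulnA leq_mul2l; apply/orP; right.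
  rewrite -[14 * n]/(7 * 2 * n) -mulnA ![_ ^ (7 * _)]expnM -expnM [n * 2]mulnC -expnMn.
  by rewrite leq_exp2r ?double_le_exp // muln_gt0 /=; apply: leq_trans n30.
(* With b = 2^l0 - 5, the cost 5 + a + b of this round raises the factor j+1 of 2^l0 exactly to
   j+2. *)
have ab : 2 ^ l0 * j.+1 * (2 * (14 * n)) <= 2 ^ (n - 5) * (2 ^ l0 - 5).
  have jM : 56 * n * j.+1 <= 2 ^ (n - 5).
    by apply: leq_trans q; rewrite -mulnn; move: j5l ln; clear; nia.
  by move: A10 jM; move: (2 ^ l0) (2 ^ (n - 5)); clear; nia.
have bounds : (2 ^ n) ^ 8 < #|W| <= (2 ^ n) ^ 10.
  by rewrite -!expnM ![n * _]mulnC Wn (leq_trans Wl) // leq_exp2l.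
have small (V : {set T}) : #|V| <= (2 ^ n) ^ 8 -> has_spanner e 7 V (2 ^ l0 * j.+1 * #|V|).
  by rewrite -expnM mulnC; apply: IHj.
apply: has_spanner_leq (spanner_step pM M8 kM pk ab bounds small).
rewrite leq_mul2r; apply/orP; right; rewrite [_ * j.+2]mulnS.
by move: (_ * j.+1) => a; move: A10; clear; lia.
Qed.

End Recursion.

(** * Discretisation of curves *)

Definition walk_in (A : pred point) (p q : point) : Prop :=
  exists s, [/\ path gadj p s, last p s = q & {in s, forall z, A z}].

Lemma walk_in_trans A p q r : walk_in A p q -> walk_in A q r -> walk_in A p r.
Proof.
move=> [s [ps sq sA]] [t [qt tr tA]]; exists (s ++ t).
rewrite cat_path last_cat ps sq; split=> // z.
by rewrite mem_cat => /orP[/sA|/tA].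
Qed.

Definition near (d : nat) (p q : point) : bool :=
  [&& p.1 <= q.1 + d, q.1 <= p.1 + d, p.2 <= q.2 + d & q.2 <= p.2 + d].

Lemma walk_in_block c p q : near 1 c p -> near 1 c q -> walk_in (near 1 c) p q.
Proof.
have hor a a' b : near 1 c (a, b) -> near 1 c (a', b) -> walk_in (near 1 c) (a, b) (a', b).
  move: {2}(a - a' + (a' - a)) (leqnn (a - a' + (a' - a))) => n.
  elim: n a => [|n IHn] a dn ca ca'; first by exists [::]; split=> //=; congr (_, _); lia.
  have [aa'|a'a|->] := ltngtP a a'; last by exists [::].
    have ca1 : near 1 c (a.+1, b) by move: ca ca' aa'; rewrite /near /=; clear; lia.
    apply: walk_in_trans (IHn a.+1 _ ca1 ca'); last by move: dn aa'; clear; lia.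
    exists [:: (a.+1, b)]; split=> // [|z]; first by rewrite /gadj /= !eqxx orbT.
    by rewrite inE => /eqP->.
  have ca1 : near 1 c (a.-1, b) by move: ca ca' a'a; rewrite /near /=; clear; lia.
  apply: walk_in_trans (IHn a.-1 _ ca1 ca'); last by move: dn a'a; clear; lia.
  exists [:: (a.-1, b)]; split=> // [|z]; last by rewrite inE => /eqP->.
  by rewrite /gadj /= eqxx prednK ?eqxx ?orbT // (leq_trans _ a'a).
have ver a b b' : near 1 c (a, b) -> near 1 c (a, b') -> walk_in (near 1 c) (a, b) (a, b').
  move: {2}(b - b' + (b' - b)) (leqnn (b - b' + (b' - b))) => n.
  elim: n b => [|n IHn] b dn cb cb'; first by exists [::]; split=> //=; congr (_, _); lia.
  have [bb'|b'b|->] := ltngtP b b'; last by exists [::].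
    have cb1 : near 1 c (a, b.+1) by move: cb cb' bb'; rewrite /near /=; clear; lia.
    apply: walk_in_trans (IHn b.+1 _ cb1 cb'); last by move: dn bb'; clear; lia.
    exists [:: (a, b.+1)]; split=> // [|z]; first by rewrite /gadj /= !eqxx.
    by rewrite inE => /eqP->.
  have cb1 : near 1 c (a, b.-1) by move: cb cb' b'b; rewrite /near /=; clear; lia.
  apply: walk_in_trans (IHn b.-1 _ cb1 cb'); last by move: dn b'b; clear; lia.
  exists [:: (a, b.-1)]; split=> // [|z]; last by rewrite inE => /eqP->.
  by rewrite /gadj /= eqxx prednK ?eqxx ?orbT // (leq_trans _ b'b).
case: p q => [a b] [a' b'] cp cq.
have cm : near 1 c (a', b) by move: cp cq; rewrite /near /=; clear; lia.
exact: walk_in_trans (hor _ _ _ cp cm) (ver _ _ _ cm cq).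
Qed.

Definition block (c : point) : seq point :=
  [seq (a, b) | a <- iota c.1.-1 3, b <- iota c.2.-1 3].

Lemma mem_block c p : 0 < c.1 -> 0 < c.2 -> (p \in block c) = near 1 c p.
Proof.
case: c p => [a b] [a' b'] a0 b0; rewrite /= in a0 b0; apply/allpairsP/idP.
  case=> -[x y] [+ + [-> ->]]; rewrite !mem_iota /near /= => xa yb.
  by move: a0 b0 xa yb; clear; lia.
move=> cp; exists (a', b'); rewrite !mem_iota; split=> //;
  by move: a0 b0 cp; rewrite /near /=; clear; lia.
Qed.

(** Each visited cell is thickened to a 3 by 3 block. Blocks share a point exactly when their
    centres are at sup distance at most 2, and blocks of consecutive cells overlap, so every string
    is connected. *)
Lemma grid_strings_of_cells (T : finType) (e : rel T) (cell : T -> nat -> point) (m N : nat) :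
  (forall u i, [&& 1 < (cell u i).1, 1 < (cell u i).2,
                   (cell u i).1.+1 < N & (cell u i).2.+1 < N]) ->
  (forall u i, i < m -> near 1 (cell u i) (cell u i.+1)) ->
  (forall u v, e u v -> exists i j, [/\ i <= m, j <= m & near 2 (cell u i) (cell v j)]) ->
  (forall u v i j, u != v -> i <= m -> j <= m -> near 2 (cell u i) (cell v j) -> e u v) ->
  grid_strings e (fun u => flatten [seq block (cell u i) | i <- iota 0 m.+1]) N.
Proof.
move=> inside step meets apart; set S := fun u => _.
have memS u p : p \in S u <-> exists2 i, i <= m & near 1 (cell u i) p.
  have pos i : 0 < (cell u i).1 /\ 0 < (cell u i).2.
    by have /and4P[c1 c2 _ _] := inside u i; split; apply: ltnW.
  split=> [/flatten_mapP[i]|[i im ip]].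
    rewrite mem_iota /= ltnS => im; have [c1 c2] := pos i.
    by rewrite mem_block // => ip; exists i.
  apply/flatten_mapP; exists i; first by rewrite mem_iota /= ltnS.
  by have [c1 c2] := pos i; rewrite mem_block.
have near0 c d : near d c c by rewrite /near !leq_addr.
split=> [u|u p /memS[i im]|u p q /memS[i im ip] /memS[j jm jq]|u v /meets[i [j [im jm]]]|u v p uv].
- have : cell u 0 \in S u by apply/memS; exists 0.
  by case: (S u).
- by have := inside u i; rewrite /near /inside_box; clear; lia.
- have blockS k z z' : k <= m -> near 1 (cell u k) z -> near 1 (cell u k) z' ->
      walk_in (mem (S u)) z z'.
    move=> km kz kz'; have [s [zs sz' sk]] := walk_in_block kz kz'.
    by exists s; split=> // y /sk ky; apply/memS; exists k.
  have along k l : k + l <= m -> walk_in (mem (S u)) (cell u k) (cell u (k + l)) /\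
      walk_in (mem (S u)) (cell u (k + l)) (cell u k).
    elim: l => [|l IHl] klm; first by rewrite addn0; split; apply: (blockS k); rewrite // -(addn0 k).
    rewrite addnS in klm *; have [there back] := IHl (ltnW klm).
    have kl := step u _ klm; have kl' := near0 (cell u (k + l)) 1.
    split; first exact: walk_in_trans there (blockS _ _ _ (ltnW klm) kl' kl).
    exact: walk_in_trans (blockS _ _ _ (ltnW klm) kl kl') back.
  suff [s [ps sq sS]] : walk_in (mem (S u)) p q by exists s; split.
  apply: walk_in_trans (blockS i _ _ im ip (near0 _ _)) _.
  apply: walk_in_trans _ (blockS j _ _ jm (near0 _ _) jq).
  have [ij|/ltnW ji] := leqP i j.
    by rewrite -(subnKC ij); apply: (along i (j - i) _).1; rewrite subnKC.
  by rewrite -(subnKC ji); apply: (along j (i - j) _).2; rewrite subnKC.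
(* The rounded midpoint of the two cells lies in both blocks. *)
- move=> ij; pose c := ((minn (cell u i).1 (cell v j).1 + maxn (cell u i).1 (cell v j).1)./2,
    (minn (cell u i).2 (cell v j).2 + maxn (cell u i).2 (cell v j).2)./2).
  apply/hasP; exists c; apply/memS; [exists j|exists i] => //.
    by move: ij; rewrite /near /c /=; clear; lia.
  by move: ij; rewrite /near /c /=; clear; lia.
- move=> /memS[i im ip] /memS[j jm jp]; apply: (apart u v i j) => //.
  by move: ip jp; rewrite /near; clear; lia.
Qed.

(** * Compactness and rounding for curves *)

Section Curves.

Local Open Scope R_scope.

Lemma continuity_eps f x eps : continuity f -> 0 < eps ->
  exists d, 0 < d /\ forall x', Rabs (x' - x) < d -> Rabs (f x' - f x) < eps.
Proof.
intros cf eps0; destruct (cf x eps eps0) as [d [d0 fd]].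
exists d; split; [exact d0|]; intros x' xx'.
destruct (Req_dec x x') as [<-|ne]; [rewrite Rminus_diag Rabs_R0; lra|].
apply fd; split; [split; [exact I|exact ne]|exact xx'].
Qed.

Lemma uniform_on_unit f eps : continuity f -> 0 < eps ->
  exists d, 0 < d /\ forall s t, 0 <= s <= 1 -> 0 <= t <= 1 ->
    Rabs (s - t) < d -> Rabs (f s - f t) < eps.
Proof.
intros cf eps0.
destruct (@Heine f _ (compact_P3 0 1) (fun x _ => cf x) (mkposreal eps eps0)) as [d fd].
exists d; split; [apply cond_pos|]; intros s t s01 t01 st.
exact (fd s t s01 t01 st).
Qed.

Lemma bounded_on_unit f : continuity f ->
  exists M, forall s, 0 <= s <= 1 -> Rabs (f s) <= M.
Proof.
intros cf.
destruct (@continuity_ab_maj f 0 1 Rle_0_1 (fun c _ => cf c)) as [a [fa _]].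
destruct (@continuity_ab_min f 0 1 Rle_0_1 (fun c _ => cf c)) as [b [fb _]].
exists (Rabs (f a) + Rabs (f b)); intros s s01.
specialize (fa s s01); specialize (fb s s01).
unfold Rabs; repeat destruct Rcase_abs; lra.
Qed.

(** Around each parameter pair some coordinate difference stays bounded away from 0. Compactness of
    the unit square makes the bound uniform; one number d serves both as local radius and as local
    gap. *)
Lemma disjoint_curves_gap x1 y1 x2 y2 :
  is_curve x1 y1 -> is_curve x2 y2 -> ~ curves_meet x1 y1 x2 y2 ->
  exists d, 0 < d /\ forall s t, 0 <= s <= 1 -> 0 <= t <= 1 ->
    d <= Rabs (x1 s - x2 t) \/ d <= Rabs (y1 s - y2 t).
Proof.
intros [cx1 cy1] [cx2 cy2] apart.
set (far d s t := d <= Rabs (x1 s - x2 t) \/ d <= Rabs (y1 s - y2 t)).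
assert (local : forall s t, {d : posreal | 0 <= s <= 1 -> 0 <= t <= 1 ->
    forall s' t', Rabs (s' - s) < d -> Rabs (t' - t) < d -> far d s' t'}).
{ intros s t; apply constructive_indefinite_description.
  destruct (classic (0 <= s <= 1 /\ 0 <= t <= 1)) as [[s01 t01]|out]; last first.
  { exists (mkposreal 1 Rlt_0_1); intros; tauto. }
  assert (gap : exists r, 0 < r /\ far r s t).
  { destruct (Req_dec (x1 s) (x2 t)) as [ex|nx].
    - exists (Rabs (y1 s - y2 t)); split; [|right; lra].
      apply Rabs_pos_lt; intros ey; apply apart; exists s, t; repeat split; lra.
    - exists (Rabs (x1 s - x2 t)); split; [|left; lra].
      apply Rabs_pos_lt; lra. }
  destruct gap as [r [r0 gap]].
  (* Each curve moves by less than r/4, so a gap of r keeps at least r/2. *)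
  assert (r4 : 0 < r / 4) by lra.
  destruct (@continuity_eps x1 s _ cx1 r4) as [a [a0 ha]].
  destruct (@continuity_eps y1 s _ cy1 r4) as [b [b0 hb]].
  destruct (@continuity_eps x2 t _ cx2 r4) as [c [c0 hc]].
  destruct (@continuity_eps y2 t _ cy2 r4) as [d [d0 hd]].
  assert (hm : exists m, 0 < m /\ m <= r / 2 /\ m <= a /\ m <= b /\ m <= c /\ m <= d).
  { exists (Rmin (r / 2) (Rmin (Rmin a b) (Rmin c d))).
    unfold Rmin; repeat destruct Rle_dec; repeat split; lra. }
  destruct hm as [m [m0 [mr [ma [mb [mc md]]]]]].
  exists (mkposreal m m0); simpl; intros _ _ s' t' ss' tt'.
  specialize (ha s' (Rlt_le_trans _ _ _ ss' ma)).
  specialize (hb s' (Rlt_le_trans _ _ _ ss' mb)).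
  specialize (hc t' (Rlt_le_trans _ _ _ tt' mc)).
  specialize (hd t' (Rlt_le_trans _ _ _ tt' md)).
  change (far m s' t').
  destruct gap as [gap|gap]; [left|right]; revert gap ha hb hc hd; clear - mr;
    unfold Rabs; repeat destruct Rcase_abs; intros; lra. }
destruct (@Compactness.compactness_value_2d 0 1 0 1 (fun s t => proj1_sig (local s t))) as [d hd].
exists d; split; [apply cond_pos|]; intros s t s01 t01.
apply NNPP; intros nfar; apply (hd s t s01 t01); intros [u [v [u01 [v01 [su [tv dd]]]]]].
apply nfar; generalize (proj2_sig (local u v) u01 v01 s t su tv).
unfold far; intros [f|f]; [left|right]; exact (Rle_trans _ _ _ dd f).
Qed.

Lemma exists_nat_bound (r : R) : exists n : nat, r <= INR n.
Proof.
exists (Z.to_nat (up (Rmax 0 r))).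
destruct (archimed (Rmax 0 r)) as [up_gt _].
pose proof (Rmax_l 0 r); pose proof (Rmax_r 0 r).
rewrite INR_IZR_INZ Z2Nat.id; [lra|].
apply le_IZR; lra.
Qed.

Lemma exists_nat_inv (d : R) : 0 < d -> exists n : nat, forall m, (n <= m)%N -> 1 <= d * INR m.
Proof.
intros d0; destruct (exists_nat_bound (/ d)) as [n hn]; exists n; intros m nm.
apply Rle_trans with (d * INR n).
- rewrite -(Rinv_r d); [|lra]; apply Rmult_le_compat_l; lra.
- apply Rmult_le_compat_l; [lra|]; apply le_INR; lia.
Qed.

Lemma finite_nat_bound (T : finType) (P : T -> nat -> Prop) :
  (forall i, exists n, forall m, (n <= m)%N -> P i m) -> exists n, forall i, P i n.
Proof.
move=> ex; suff [n hn] : exists n, forall i, i \in enum T -> forall m, (n <= m)%N -> P i m.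
  by exists n => i; apply: (hn i) => //; rewrite mem_enum.
elim: (enum T) => [|i s [n hn]]; first by exists 0%N.
have [k hk] := ex i; exists (maxn n k) => j; rewrite inE => /orP[/eqP->|js] m;
  rewrite geq_max => /andP[nm km]; first exact: hk.
exact: hn.
Qed.

Definition floor_nat (r : R) : nat := Z.to_nat (up r - 1).

Lemma floor_natP r : 0 <= r -> INR (floor_nat r) <= r < INR (floor_nat r) + 1.
Proof.
intros r0; unfold floor_nat; destruct (archimed r) as [u1 u2].
rewrite INR_IZR_INZ Z2Nat.id; [rewrite minus_IZR; lra|].
assert (0 < up r)%Z by (apply lt_IZR; lra); lia.
Qed.

Lemma floor_nat_near r r' (n : nat) : 0 <= r -> 0 <= r' -> Rabs (r - r') < INR n ->
  (floor_nat r <= floor_nat r' + n)%N.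
Proof.
intros r0 r0' rr'; pose proof (floor_natP r0) as f; pose proof (floor_natP r0') as f'.
assert (lt : INR (floor_nat r) < INR (floor_nat r' + n).+1).
{ rewrite S_INR plus_INR; revert rr'; unfold Rabs; destruct Rcase_abs; intros; lra. }
by apply INR_lt in lt; lia.
Qed.

Lemma floor_nat_far r r' (n : nat) : 0 <= r -> 0 <= r' ->
  (floor_nat r <= floor_nat r' + n)%N -> r - r' < INR n + 1.
Proof.
intros r0 r0' ff; pose proof (floor_natP r0) as f; pose proof (floor_natP r0') as f'.
assert (le : INR (floor_nat r) <= INR (floor_nat r' + n)) by (apply le_INR; lia).
rewrite plus_INR in le; lra.
Qed.

End Curves.

(** * Sampling curves on a fine grid *)

Section Discretisation.

Local Open Scope R_scope.

Lemma near_floor (d : nat) x y x' y' : 0 <= x -> 0 <= y -> 0 <= x' -> 0 <= y' ->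
  Rabs (x - x') < INR d -> Rabs (y - y') < INR d ->
  near d (floor_nat x, floor_nat y) (floor_nat x', floor_nat y').
Proof.
move=> x0 y0 x0' y0' xx' yy'; have x'x := xx'; have y'y := yy'.
rewrite Rabs_minus_sym in x'x; rewrite Rabs_minus_sym in y'y.
by rewrite /near /= !floor_nat_near.
Qed.

Lemma floor_near (d : nat) x y x' y' : 0 <= x -> 0 <= y -> 0 <= x' -> 0 <= y' ->
  near d (floor_nat x, floor_nat y) (floor_nat x', floor_nat y') ->
  Rabs (x - x') < INR d + 1 /\ Rabs (y - y') < INR d + 1.
Proof.
move=> x0 y0 x0' y0' /and4P[/= n1 n2 n3 n4].
have f1 := floor_nat_far x0 x0' n1; have f2 := floor_nat_far x0' x0 n2.
have f3 := floor_nat_far y0 y0' n3; have f4 := floor_nat_far y0' y0 n4.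
by split; unfold Rabs; destruct Rcase_abs; lra.
Qed.

Lemma scaled_uniform f (k : nat) : continuity f ->
  exists n, forall m, (n <= m)%N -> forall s t, 0 <= s <= 1 -> 0 <= t <= 1 ->
    Rabs (s - t) * INR m <= 1 -> Rabs (INR k * f s - INR k * f t) < 1.
Proof.
intros cf; pose proof (pos_INR k) as k0.
assert (eps0 : 0 < / (INR k + 1)) by (apply Rinv_0_lt_compat; lra).
destruct (uniform_on_unit cf eps0) as [d [d0 hd]].
assert (d2 : 0 < d / 2) by lra.
destruct (exists_nat_inv d2) as [n hn]; exists n; intros m nm s t s01 t01 st.
specialize (hn m nm); pose proof (pos_INR m) as m0.
assert (lt : Rabs (s - t) < d).
{ destruct (Rlt_le_dec (Rabs (s - t)) d) as [ok|bad]; [exact ok|].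
  pose proof (Rmult_le_compat_r _ _ _ m0 bad); lra. }
specialize (hd s t s01 t01 lt).
rewrite -Rmult_minus_distr_l Rabs_mult (Rabs_pos_eq (INR k)); [|exact k0].
apply Rle_lt_trans with (INR k * / (INR k + 1)).
- apply Rmult_le_compat_l; lra.
- apply Rmult_lt_reg_r with (INR k + 1); [lra|].
  rewrite Rmult_assoc Rinv_l; lra.
Qed.

(** The bound 3 is what keeps cells of disjoint curves more than 2 apart: cells at distance at most
    2 come from points less than 3 apart. *)
Lemma scaled_gap x1 y1 x2 y2 :
  is_curve x1 y1 -> is_curve x2 y2 -> ~ curves_meet x1 y1 x2 y2 ->
  exists n, forall k, (n <= k)%N -> forall s t, 0 <= s <= 1 -> 0 <= t <= 1 ->
    3 <= Rabs (INR k * x1 s - INR k * x2 t) \/ 3 <= Rabs (INR k * y1 s - INR k * y2 t).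
Proof.
intros c1 c2 apart; destruct (disjoint_curves_gap c1 c2 apart) as [d [d0 hd]].
assert (d3 : 0 < d / 3) by lra.
destruct (exists_nat_inv d3) as [n hn]; exists n; intros k nk s t s01 t01.
specialize (hn k nk); pose proof (pos_INR k) as k0.
rewrite -!Rmult_minus_distr_l !Rabs_mult (Rabs_pos_eq (INR k)); [|exact k0].
destruct (hd s t s01 t01) as [h|h]; [left|right];
  pose proof (Rmult_le_compat_l _ _ _ k0 h); lra.
Qed.

(** First choose the scale k so that disjoint curves get 3 apart, then a mesh 1/m, depending on k,
    on which scaled curves move by less than 1. Curves that meet then have samples less than 2
    apart. *)
Lemma string_graph_grid (T : finType) (e : rel T) : string_graph e ->
  symmetric e /\ exists (S : T -> seq point) (N : nat), grid_strings e S N.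
Proof.
case=> cx [cy [curve adj]].
have e_neq u v : e u v -> u <> v by move/adj => [].
have e_meet u v : e u v -> curves_meet (cx u) (cy u) (cx v) (cy v) by move/adj => [].
have e_sym : symmetric e.
  suff imp u v : e u v -> e v u by move=> u v; apply/idP/idP; apply: imp.
  case/adj=> uv [s [t [s0 [s1 [t0 [t1 [xx yy]]]]]]]; apply/adj; split; first by move/esym.
  by exists t, s.
split=> //.
have [k gap] : exists k : nat, forall p : T * T, p.1 <> p.2 -> ~ e p.1 p.2 ->
    forall s t, 0 <= s <= 1 -> 0 <= t <= 1 ->
    3 <= Rabs (INR k * cx p.1 s - INR k * cx p.2 t) \/
    3 <= Rabs (INR k * cy p.1 s - INR k * cy p.2 t).
  apply: finite_nat_bound => -[u v] /=.
  case: (classic (curves_meet (cx u) (cy u) (cx v) (cy v))) => [meet|apart].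
    by exists 0%N => m _ uv nuv; case: nuv; apply/adj.
  have [n hn] := scaled_gap (curve u) (curve v) apart.
  by exists n => m nm _ _; apply: hn.
have [B bound] : exists B : nat, forall u s, 0 <= s <= 1 ->
    Rabs (cx u s) <= INR B /\ Rabs (cy u s) <= INR B.
  apply: finite_nat_bound => u; have [cxu cyu] := curve u.
  have [a ha] := bounded_on_unit cxu; have [b hb] := bounded_on_unit cyu.
  have [n hn] := exists_nat_bound (Rabs a + Rabs b); exists n => m nm s s01.
  have nm' : INR n <= INR m by apply: le_INR; lia.
  have := ha s s01; have := hb s s01; have := Rle_abs a; have := Rle_abs b.
  have := Rabs_pos a; have := Rabs_pos b.
  by move=> *; split; lra.
have [m mesh] : exists m : nat, forall u, (0 < m)%N /\
    forall s t, 0 <= s <= 1 -> 0 <= t <= 1 -> Rabs (s - t) * INR m <= 1 ->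
    Rabs (INR k * cx u s - INR k * cx u t) < 1 /\ Rabs (INR k * cy u s - INR k * cy u t) < 1.
  apply: finite_nat_bound => u; have [cxu cyu] := curve u.
  have [n1 h1] := scaled_uniform k cxu; have [n2 h2] := scaled_uniform k cyu.
  exists (maxn n1 n2).+1 => m nm; have [m0 [m1 m2]] : (0 < m /\ n1 <= m /\ n2 <= m)%N by lia.
  split=> // s t s01 t01 st.
  by split; [exact: (h1 m m1 s t s01 t01 st) | exact: (h2 m m2 s t s01 t01 st)].
(* The shift makes all coordinates at least 2, leaving room for the blocks inside the box. *)
pose fx u s := INR k * cx u s + INR k * INR B + 2.
pose fy u s := INR k * cy u s + INR k * INR B + 2.
have range u s : 0 <= s <= 1 -> 2 <= fx u s <= 2 * (INR k * INR B) + 2 /\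
    2 <= fy u s <= 2 * (INR k * INR B) + 2.
  move=> s01; have [bx by_] := bound u s s01; have k0 := pos_INR k; rewrite /fx /fy.
  have [x1 x2] : - INR B <= cx u s /\ cx u s <= INR B.
    by move: bx; unfold Rabs; destruct Rcase_abs; lra.
  have [y1 y2] : - INR B <= cy u s /\ cy u s <= INR B.
    by move: by_; unfold Rabs; destruct Rcase_abs; lra.
  have := Rmult_le_compat_l _ _ _ k0 x1; have := Rmult_le_compat_l _ _ _ k0 x2.
  have := Rmult_le_compat_l _ _ _ k0 y1; have := Rmult_le_compat_l _ _ _ k0 y2.
  by move=> *; lra.
have fx_sub u v s t : fx u s - fx v t = INR k * cx u s - INR k * cx v t by rewrite /fx; lra.
have fy_sub u v s t : fy u s - fy v t = INR k * cy u s - INR k * cy v t by rewrite /fy; lra.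
(* Clamping at m keeps every index in the unit interval, as the cell bounds are required for all
   i. *)
pose time i := INR (minn i m) / INR m.
have m_pos : (0 < m)%N -> 0 < INR m by move=> m0; apply: lt_0_INR; lia.
have time01 i : (0 < m)%N -> 0 <= time i <= 1.
  move=> /m_pos m0; rewrite /time; split.
    by apply: Rmult_le_pos; [apply: pos_INR | apply/Rlt_le/Rinv_0_lt_compat].
  apply: (Rmult_le_reg_r (INR m)) => //; rewrite /Rdiv Rmult_assoc Rinv_l; last lra.
  by rewrite Rmult_1_r Rmult_1_l; apply: le_INR; have := geq_minr i m; lia.
pose cell u i := (floor_nat (fx u (time i)), floor_nat (fy u (time i))).
exists (fun u => flatten [seq block (cell u i) | i <- iota 0 m.+1]).
exists (2 * (k * B) + 5)%N; apply: grid_strings_of_cells => [u i|u i im|u v uv|u v i j uv im jm].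
- have [m0 _] := mesh u; have [rx ry] := range u _ (time01 i m0).
  have inside r : 2 <= r <= 2 * (INR k * INR B) + 2 ->
      (1 < floor_nat r)%N /\ ((floor_nat r).+1 < 2 * (k * B) + 5)%N.
    move=> [r1 r2]; have [|f1 f2] := @floor_natP r; first lra.
    split.
      have f : INR 1 < INR (floor_nat r) by rewrite /=; lra.
      by move/INR_lt: f => f; lia.
    have f : INR (floor_nat r).+1 < INR (2 * (k * B) + 5).
      by rewrite S_INR plus_INR !mult_INR /=; lra.
    by move/INR_lt: f => f; lia.
  have [x1 x2] := inside _ rx; have [y1 y2] := inside _ ry.
  by rewrite /cell /= x1 y1 x2 y2.
- have [m0 unif] := mesh u; have mp := m_pos m0.
  have [rx ry] := range u _ (time01 i m0); have [rx' ry'] := range u _ (time01 i.+1 m0).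
  have [|ux uy] := unif _ _ (time01 i m0) (time01 i.+1 m0).
    rewrite /time (minn_idPl im) (minn_idPl (ltnW im)) S_INR.
    have -> : INR i / INR m - (INR i + 1) / INR m = - / INR m by field; lra.
    rewrite Rabs_Ropp Rabs_pos_eq; last by apply/Rlt_le/Rinv_0_lt_compat.
    by rewrite Rinv_l; lra.
  by apply: near_floor; rewrite ?fx_sub ?fy_sub //; lra.
- have [s [t [s0 [s1 [t0 [t1 [xx yy]]]]]]] := e_meet u v uv.
  have [m0 unifu] := mesh u; have [_ unifv] := mesh v; have mp := m_pos m0.
  have sample r : 0 <= r <= 1 -> exists2 i, (i <= m)%N & Rabs (time i - r) * INR m <= 1.
    move=> r01; have rm0 : 0 <= r * INR m by apply: Rmult_le_pos; lra.
    have [f1 f2] := floor_natP rm0; set i := floor_nat _ in f1 f2.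
    have im : (i <= m)%N.
      have := Rmult_le_compat_r _ _ _ (Rlt_le _ _ mp) (proj2 r01) => rm.
      have le : INR i <= INR m by lra.
      by move/INR_le: le; lia.
    exists i => //; rewrite -(Rabs_pos_eq (INR m)); last exact: Rlt_le.
    rewrite -Rabs_mult /time (minn_idPl im).
    have -> : (INR i / INR m - r) * INR m = INR i - r * INR m by field; lra.
    by unfold Rabs; destruct Rcase_abs; lra.
  have [i im is_] := sample s (conj s0 s1); have [j jm jt] := sample t (conj t0 t1).
  have [ux uy] := unifu _ _ (time01 i m0) (conj s0 s1) is_.
  have [vx vy] := unifv _ _ (time01 j m0) (conj t0 t1) jt.
  have [rx ry] := range u _ (time01 i m0); have [rx' ry'] := range v _ (time01 j m0).
  exists i, j; split=> //; apply: near_floor; rewrite ?fx_sub ?fy_sub; try lra.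
    by move: ux vx; rewrite xx /=; unfold Rabs; do !destruct Rcase_abs; lra.
  by move: uy vy; rewrite yy /=; unfold Rabs; do !destruct Rcase_abs; lra.
have [m0 _] := mesh u.
have [rx ry] := range u _ (time01 i m0); have [rx' ry'] := range v _ (time01 j m0).
move=> /floor_near[]; try lra; rewrite fx_sub fy_sub /= => nx ny.
apply: NNPP => nuv; have [] := gap (u, v) _ nuv _ _ (time01 i m0) (time01 j m0) => //=; [exact/eqP|lra|lra].
Qed.

End Discretisation.

(** * Counting *)

(** Hides the explicit constants; the estimates that follow use only 3 <= l0. *)
Lemma string_graph_spanner : exists l0 A : nat, 3 <= l0 /\
  forall (T : finType) (e : rel T) (j l : nat), string_graph e ->
    5 ^ j * l <= l0 * 6 ^ j -> #|T| <= 2 ^ l ->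
    has_spanner e 7 [set: T] (A * j.+1 * #|T|).
Proof.
exists 300, (2 ^ 300); split=> // T e j l /string_graph_grid[e_sym [S [N eS]]] jl Tl.
by rewrite -cardsT; apply: (spanner_bound e_sym eS (leqnn 300) jl); rewrite cardsT.
Qed.

(** Symmetrising E at most doubles its pairs, and [num_edges] halves the count of ordered pairs. *)
Lemma hop_spanner_of_has_spanner (T : finType) (e : rel T) (t m : nat) :
  symmetric e -> has_spanner e t [set: T] m ->
  exists h : rel T, hop_spanner e h t /\ num_edges h <= m.
Proof.
move=> e_sym [E [Ee Em Ej]]; exists (undirected E); split.
  split; first by move=> u v /orP[/Ee|/Ee] //=; rewrite e_sym.
  split=> [u v|u v uv]; first by rewrite undirected_sym.
  by have [s [us sv st]] := Ej u v (in_setT u) (in_setT v) uv; exists s.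
rewrite /num_edges; set H := [set p | _].
have HE : H \subset E :|: [set (p.2, p.1) | p in E].
  apply/subsetP=> -[u v]; rewrite !inE => /orP[->//|vu]; apply/orP; right.
  by apply/imsetP; exists (v, u).
have : #|H| <= #|E| + #|E|.
  apply: leq_trans (subset_leq_card HE) (leq_trans (leq_card_setU _ _) _).
  by rewrite leq_add2l leq_imset_card.
by move: Em; clear; lia.
Qed.

Lemma iterations_exist (l0 l : nat) : 3 <= l0 -> 0 < l -> exists j,
  5 ^ j * l <= l0 * 6 ^ j /\ (0 < j -> l0 * 6 ^ j.-1 < 5 ^ j.-1 * l).
Proof.
move=> l03 l_pos.
have ex : exists j, 5 ^ j * l <= l0 * 6 ^ j.
  (* Bernoulli's inequality gives 5^(2l) * 2l <= 5 * 6^(2l), and 5/2 is below 3 <= l0. *)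
  exists (2 * l); have := bernoulli_nat 5 (2 * l).
  by move: (5 ^ _) (6 ^ _) => x y; move: l03 l_pos; clear; nia.
case: (ex_minnP ex) => j jl min; exists j; split=> // j0.
by rewrite ltnNge; apply/negP=> /min; rewrite leqNgt prednK // leqnn.
Qed.

(** * Estimates with iterated logarithms *)

Section LogLog.

Local Open Scope R_scope.

Lemma INR_exp (a n : nat) : INR (a ^ n)%N = INR a ^ n.
Proof. by elim: n => [|n IHn]; rewrite ?expn0 ?expnS ?mult_INR ?IHn. Qed.

Lemma ln4_gt1 : 1 < ln 4.
Proof.
have -> : 4 = 2 * 2 by lra.
by rewrite ln_mult; have := ln_lt_2; lra.
Qed.

Lemma ln_ln4_gt0 : 0 < ln (ln 4).
Proof. by rewrite -ln_1; apply: ln_increasing; [lra | exact: ln4_gt1]. Qed.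

(** The first summand pays for an additive 2, as ln ln n >= ln ln 4 > 0; the second pays for the
    rounds that multiply by 6/5. *)
Definition loglog_factor : R := 2 / ln (ln 4) + / ln (6 / 5).

(** Minimality of j gives (6/5)^(j-1) < l/l0 <= l/3 < ln n; then take logarithms. *)
Lemma iterations_le_loglog (l0 n l j : nat) :
  (3 <= l0)%N -> (4 <= n)%N -> (2 ^ l.-1 < n)%N ->
  ((0 < j)%N -> (l0 * 6 ^ j.-1 < 5 ^ j.-1 * l)%N) ->
  INR j.+1 <= loglog_factor * ln (ln (INR n)).
Proof.
move=> l03 n4 l2n jmin.
have ln_le x y : 0 < x -> x <= y -> ln x <= ln y.
  by move=> x0 [xy|->]; [apply/Rlt_le/ln_increasing | apply: Rle_refl].
have ln4 := ln4_gt1; have lnln4 := ln_ln4_gt0; have ln2 := ln_lt_2.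
have n4' : 4 <= INR n.
  by have : INR 4 <= INR n; [apply: le_INR; lia | rewrite /=; lra].
have lnn : ln 4 <= ln (INR n) by apply: ln_le; lra.
have lnlnn : ln (ln 4) <= ln (ln (INR n)) by apply: ln_le; lra.
have ln65 : 0 < ln (6 / 5) by rewrite -ln_1; apply: ln_increasing; lra.
have two : 2 <= 2 / ln (ln 4) * ln (ln (INR n)).
  rewrite -{1}(Rmult_1_r 2) /Rdiv Rmult_assoc; apply: Rmult_le_compat_l; first lra.
  apply: (Rmult_le_reg_l (ln (ln 4))) => //.
  by rewrite -Rmult_assoc Rinv_r; lra.
rewrite /loglog_factor Rmult_plus_distr_r; case: j jmin => [_|j /(_ isT) lj].
  have : 0 <= / ln (6 / 5) * ln (ln (INR n)).
    by apply: Rmult_le_pos; [apply/Rlt_le/Rinv_0_lt_compat|lra].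
  by rewrite /=; lra.
rewrite /= in lj.
(* From ln 2 > 1/2 one gets l - 1 < 2 ln n, and 1 < ln 4 <= ln n absorbs the remaining 1. *)
have l3 : INR l < 3 * ln (INR n).
  have : ln (2 ^ l.-1) < ln (INR n).
    apply: ln_increasing; first by apply: pow_lt; lra.
    have -> : 2 = INR 2 by rewrite /=; lra.
    by rewrite -INR_exp; apply: lt_INR; lia.
  rewrite ln_pow; last lra.
  case: (l) => [|l'] /=; first lra.
  rewrite -/(INR l'.+1) S_INR; have := pos_INR l'; nra.
have pow_lt_l : (6 / 5) ^ j < ln (INR n).
  have lj' : INR (l0 * 6 ^ j)%N < INR (5 ^ j * l)%N by apply: lt_INR; lia.
  rewrite !mult_INR !INR_exp in lj'.
  have l03' : 3 <= INR l0.
    by have : INR 3 <= INR l0; [apply: le_INR; lia | rewrite /=; lra].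
  have p6 : 0 < INR 6 ^ j by apply: pow_lt; rewrite /=; lra.
  have p5 : 0 < INR 5 ^ j by apply: pow_lt; rewrite /=; lra.
  have -> : (6 / 5) ^ j = INR 6 ^ j / INR 5 ^ j.
    rewrite /Rdiv Rpow_mult_distr pow_inv; congr (_ ^ _ * / _ ^ _); rewrite /=; lra.
  apply: (Rmult_lt_reg_r (INR 5 ^ j)) => //.
  rewrite /Rdiv Rmult_assoc Rinv_l; last lra.
  nra.
have : ln ((6 / 5) ^ j) < ln (ln (INR n)).
  by apply: ln_increasing => //; apply: pow_lt; lra.
rewrite ln_pow; last lra.
move=> jln; have jlt : INR j <= / ln (6 / 5) * ln (ln (INR n)).
  apply: (Rmult_le_reg_l (ln (6 / 5))) => //.
  by rewrite -Rmult_assoc Rinv_r; lra.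
by rewrite !S_INR; lra.
Qed.

Lemma loglog_size (A j m n : nat) (c x : R) : INR j.+1 <= c * x ->
  (m <= A * j.+1 * n)%N -> INR m <= INR A * c * INR n * x.
Proof.
move=> jx mn; apply: Rle_trans (_ : INR (A * j.+1 * n)%N <= _).
  by apply: le_INR; lia.
rewrite !mult_INR (_ : INR A * c * INR n * x = INR A * (c * x) * INR n); last by ring.
apply: Rmult_le_compat_r (pos_INR n) _.
exact: Rmult_le_compat_l (pos_INR A) jx.
Qed.

End LogLog.

Theorem theorem4 :
  exists C : R,
    forall (T : finType) (e : rel T),
      string_graph e -> (4 <= #|T|)%N ->
      exists h : rel T,
        hop_spanner e h 7 /\
        Rle (INR (num_edges h)) (Rmult (Rmult C (INR #|T|)) (ln (ln (INR #|T|)))).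
Proof.
have [l0 [A [l03 spanner]]] := string_graph_spanner.
exists (Rmult (INR A) loglog_factor) => T e eT n4.
have n1 : 1 < #|T| by apply: leq_trans n4.
have l_pos : 0 < up_log 2 #|T| by rewrite up_log_gt0.
have [j [jl jmin]] := iterations_exist l03 l_pos.
have [e_sym _] := string_graph_grid eT.
have [h [hh hm]] := hop_spanner_of_has_spanner e_sym (spanner T e j _ eT jl (up_logP #|T| (isT : 1 < 2))).
exists h; split=> //.
have l2n := up_log_gtn (isT : 1 < 2) n1.
exact: loglog_size (iterations_le_loglog l03 n4 l2n jmin) hm.
Qed.
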